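(* There exists an infinite sequence $\{G_i\}_{i=1}^\infty$ of pairwise non-isomorphic finite (uncolored) graphs such that, for every $i$, the automorphism group $\mathrm{Aut}(G_i)$ is trivial and the quantum automorphism group $\mathrm{Qut}(G_i)$ is non-trivial.
   Context: A graph $G=(V(G),E(G))$ is finite, undirected, without loops or parallel edges: $V(G)$ is a finite set and $E(G)\subseteq V(G)\times V(G)$ is symmetric and contains no pair $(i,i)$. The quantum automorphism group $\mathrm{Qut}(G)$ is the compact matrix quantum group $(C(\mathrm{Qut}(G)),u)$, where $C(\mathrm{Qut}(G))$ is the universal unital $C^*$-algebra with generators $u_{ij}$, $i,j\in V(G)$, and relations: $u_{ij}=u_{ij}^*=u_{ij}^2$ for all $i,j$; $\sum_l u_{il}=1=\sum_l u_{li}$ for all $i$; and $u_{ij}u_{kl}=0$ whenever exactly one of $(i,k)\in E(G)$, $(j,l)\in E(G)$ holds. The comultiplication is $\Delta(u_{ij})=\sum_k u_{ik}\otimes u_{kj}$. $\mathrm{Qut}(G)$ is trivial if $C(\mathrm{Qut}(G))=\mathbb{C}$, and non-trivial otherwise. $\mathrm{Aut}(G)$ is the usual automorphism group. *)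

(* Defs.v *)
From HB Require Import structures.
From mathcomp Require Import all_boot all_order all_fingroup all_algebra.
From mathcomp Require Import complex.
From mathcomp Require Import boolp classical_sets reals topology normedtype.

Set Implicit Arguments.
Unset Strict Implicit.
Unset Printing Implicit Defensive.

Import Order.TTheory GRing.Theory Num.Theory.
Import numFieldNormedType.Exports.

Local Open Scope classical_set_scope.
Local Open Scope ring_scope.
Local Open Scope complex_scope.

Record graph := Graph {
  vertex :> finType;
  edge : rel vertex;
  edge_sym : symmetric edge;
  edge_irr : irreflexive edge
}.

Definition graph_iso (G H : graph) : Prop :=
  exists2 f : G -> H, bijective f & forall x y, edge (f x) (f y) = edge x y.

Definition graph_aut (G : graph) : {set {perm G}} :=
  [set s : {perm G} | [forall x, forall y, edge (s x) (s y) == edge x y]]%SET.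

(* The norm is a field of the structure, not the [`|x|] of [normedModType]: the
   latter takes values in [R[i]], and HB rejects a join of rings with normed
   modules declared after [numDomainType]. Completeness is stated for Cauchy
   sequences. The zero algebra is allowed: [algType] does not require
   [1 != 0]. *)
HB.mixin Record isCStarAlgebra (R : realType) A & GRing.Algebra R[i] A := {
  star : A -> A;
  starK : involutive star;
  starD : {morph star : x y / x + y};
  starZ : forall (a : R[i]) (x : A), star (a *: x) = a^* *: star x;
  starM : forall x y : A, star (x * y) = star y * star x;
  cnorm : A -> R;
  cnorm_eq0 : forall x : A, cnorm x = 0 -> x = 0;
  cnormD : forall x y : A, cnorm (x + y) <= cnorm x + cnorm y;
  cnormZ : forall (a : R[i]) (x : A), cnorm (a *: x) = Normc.normc a * cnorm x;
  cnormM : forall x y : A, cnorm (x * y) <= cnorm x * cnorm y;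
  cnorm_starM : forall x : A, cnorm (star x * x) = cnorm x ^+ 2;
  cnorm_complete : forall x : nat -> A,
    (forall e : R, 0 < e ->
       exists N, forall m n, (N <= m)%N -> (N <= n)%N -> cnorm (x m - x n) < e) ->
    exists l : A, cnorm (x n - l) @[n --> \oo] --> (0 : R)
}.

#[short(type="cstarAlgType")]
HB.structure Definition CStarAlgebra (R : realType) :=
  {A of GRing.Algebra R[i] A & isCStarAlgebra R A}.

Section ComplexCStar.
Variable R : realType.
Local Notation C := (R[i]^o).
Implicit Types (x y : C).

Let complete (x : nat -> C) :
  (forall e : R, 0 < e ->
     exists N, forall m n, (N <= m)%N -> (N <= n)%N ->
       Normc.normc (x m - x n) < e) ->
  exists l : C, Normc.normc (x n - l) @[n --> \oo] --> (0 : R).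
Proof.
move=> xC.
have Re_le (z : R[i]) : (`|complex.Re z| : R) <= Normc.normc z.
  case: z => a b /=; rewrite -sqrtr_sqr ler_wsqrtr//.
  by rewrite lerDl sqr_ge0.
have Im_le (z : R[i]) : (`|complex.Im z| : R) <= Normc.normc z.
  case: z => a b /=; rewrite -sqrtr_sqr ler_wsqrtr//.
  by rewrite lerDr sqr_ge0.
have cvgP (f : {additive R[i] -> R}) : (forall z, (`|f z| : R) <= Normc.normc z) ->
    exists l : R, f (x n) @[n --> \oo] --> l.
  move=> fle; exists (lim (f (x n) @[n --> \oo])).
  apply/cauchy_cvgP/cauchy_ballP => e e0.
  have [N xN] := xC e e0.
  exists ([set f (x n) | n in [set n | (N <= n)%N]],
          [set f (x n) | n in [set n | (N <= n)%N]]) => /=.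
    by split; exists N => // n /= Nn; exists n.
  move=> [_ _] [/= [m Nm <-] [n Nn <-]].
  rewrite /ball/= -raddfB; exact: le_lt_trans (fle _) (xN _ _ Nm Nn).
have [a xa] := cvgP (@complex.Re R) Re_le.
have [b xb] := cvgP (@complex.Im R) Im_le.
exists (a +i* b).
have le_norm (z : R[i]) : Normc.normc z <= `|complex.Re z| + `|complex.Im z| :> R.
  case: z => c d /=.
  rewrite -(ler_pXn2r (_ : 0 < 2)%N) ?nnegrE ?sqrtr_ge0 ?addr_ge0//.
  rewrite sqr_sqrtr ?addr_ge0 ?sqr_ge0// sqrrD !real_normK ?num_real//.
  by rewrite addrAC lerDl mulrn_wge0// mulr_ge0.
apply: (@squeeze_cvgr _ _ _ _ (fun=> 0)
  (fun n => `|complex.Re (x n) - a| + `|complex.Im (x n) - b|)).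
- near=> n; apply/andP; split; first exact: le_trans (Re_le _).
  apply: le_trans (le_norm _) _.
  by rewrite !raddfB.
- exact: cvg_cst.
- have := cvgD (cvg_norm (cvgB xa (cvg_cst a))) (cvg_norm (cvgB xb (cvg_cst b))).
  by rewrite !subrr !normr0 addr0; apply.
Unshelve. all: by end_near. Qed.

Let conjM x y : conjc (x * y) = conjc y * conjc x.
Proof. by rewrite mulrC rmorphM. Qed.

Let normcD x y : Normc.normc (x + y) <= Normc.normc x + Normc.normc y.
Proof. by rewrite -lecR rmorphD/=; exact: (@ler_normD _ R[i]). Qed.

Let normcM_le x y : Normc.normc (x * y) <= Normc.normc x * Normc.normc y.
Proof. by rewrite Normc.normcM. Qed.

Let normc_conjM x : Normc.normc (conjc x * x) = Normc.normc x ^+ 2.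
Proof. by rewrite Normc.normcM expr2; congr (_ * _); case: x => a b/=; rewrite sqrrN. Qed.

HB.instance Definition _ := @isCStarAlgebra.Build R C (@conjc R)
  (@conjcK R) (rmorphD _) (fun a x => rmorphM _ a x) conjM
  (@Normc.normc R) (@Normc.eq0_normc R) normcD (@Normc.normcM R) normcM_le normc_conjM
  complete.

End ComplexCStar.

(* Injective *-homomorphisms of C*-algebras are automatically isometric, so no
   condition on the norms is needed. *)
Definition cstar_iso (R : realType) (A B : cstarAlgType R) : Prop :=
  exists2 f : {lrmorphism A -> B}, {morph f : x / star x} & bijective f.

Definition cstar_generated (R : realType) (A : cstarAlgType R) (S : set A) : Prop :=
  forall B : set A,
    S `<=` B -> B 1 ->
    (forall x y, B x -> B y -> B (x + y)) ->
    (forall x y, B x -> B y -> B (x * y)) ->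
    (forall (a : R[i]) x, B x -> B (a *: x)) ->
    (forall x, B x -> B (star x)) ->
    (forall (x : nat -> A) (l : A), (forall n, B (x n)) ->
       cnorm (x n - l) @[n --> \oo] --> (0 : R) -> B l) ->
    B = setT.

Record qut_relations (R : realType) (G : graph) (A : cstarAlgType R)
    (u : G -> G -> A) : Prop := {
  qut_star : forall i j, star (u i j) = u i j;
  qut_idem : forall i j, u i j * u i j = u i j;
  qut_row : forall i, \sum_l u i l = 1;
  qut_col : forall i, \sum_l u l i = 1;
  qut_edge : forall i j k l, edge i k != edge j l -> u i j * u k l = 0
}.

(* [(A, u)] is [(C(Qut(G)), u)], the universal unital C*-algebra on the generators
   [u i j] and [qut_relations]. The extension of [v] to [A] is unique, because
   *-homomorphisms are automatically contractive and [u] generates [A]. *)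
Record is_CQut (R : realType) (G : graph) (A : cstarAlgType R)
    (u : G -> G -> A) : Prop := {
  CQut_relations : qut_relations u;
  CQut_generated : cstar_generated [set u p.1 p.2 | p in [set: G * G]];
  CQut_universal : forall (B : cstarAlgType R) (v : G -> G -> B),
    qut_relations v ->
    exists2 f : {lrmorphism A -> B},
      {morph f : x / star x} & forall i j, f (u i j) = v i j
}.

(* C(Qut(G)) is defined up to isomorphism, hence the quantifier over its models
   [(A, u)]. The negation asserts that C(Qut(G)) exists and is not isomorphic to
   the complex numbers. *)
Definition Qut_trivial (R : realType) (G : graph) : Prop :=
  forall (A : cstarAlgType R) (u : G -> G -> A),
    is_CQut u -> cstar_iso A R[i]^o.

(* Main.v *)
Require Import Defs.
From HB Require Import structures.
From mathcomp Require Import all_boot all_order all_fingroup all_algebra.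
From mathcomp Require Import complex.
From mathcomp Require Import boolp classical_sets reals topology normedtype.
From mathcomp Require Import ring lra zify.

Set Implicit Arguments.
Unset Strict Implicit.
Unset Printing Implicit Defensive.

Import Order.TTheory GRing.Theory Num.Theory.
Import numFieldNormedType.Exports.

Local Open Scope classical_set_scope.
Local Open Scope ring_scope.
Local Open Scope complex_scope.

(** A system of equations f(a) + f(b) = f(c) over the field with two elements has
quantum solutions: involutions X_i with X_a X_b = X_c for every equation. From
such a system, with at least two equations, one builds a graph whose
automorphisms are exactly the solutions f, and on which a quantum solution X still acts, as a quantum automorphism. So
it suffices to find systems with f = 0 as only solution and with a quantum
solution that is not made of signs.

If D is a set of involutions of a finite group, and the equations are the
relations x y = z inside D, then any permutation representation of the group is
a quantum solution, whereas a solution is a map D -> F_2 that is additive on the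
pairs whose product is in D. For D the set of double transpositions (a b)(c d) of
at least eight points every solution vanishes (lemma
[double_tperms_trivial_hom]). The relations
(a b)(c d) * (a b)(x y) = (c d)(x y) make f a sum of an edge function h over the
two transpositions; the Klein four-groups on {a, b, c, d} then say that h sums to
zero over the edges of every K_4, which forces h to be constant; hence f is zero.

In the graph, a variable i is a pair of vertices [literal i e], an equation is
the set of its four local solutions, and a local solution is adjacent to the
three literals that it satisfies. To make the graph uncolored, a clique of
anchors, one for each variable, is added: the anchors have the highest degrees
and these degrees are distinct, so that automorphisms fix them, and the anchors
adjacent to a literal reveal its variable (lemma [system_graph_asymmetric]).
The quantum automorphism is block diagonal; its blocks consist of the spectral
projections of the X_i and of their products over an equation
(lemma [system_magic_relations]).

Non-triviality of Qut also requires that the universal C*-algebra exists.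
It is obtained in lemma [CQut_is_CQut] as the algebra of those families of
elements, indexed by all representations of the relations, that are uniform
limits of *-polynomials in the generators. A representation with a generator
other than 0 and 1 prevents this algebra from being the complex numbers, because
the only idempotents of the field of complex numbers are 0 and 1; the
representation used here is by permutation matrices, which requires the C*-norm
on matrices. *)

(** * The universal C*-algebra of a graph *)

Lemma normc_ge0 (R : rcfType) (a : R[i]) : 0 <= Normc.normc a.
Proof. by case: a => u v; rewrite sqrtr_ge0. Qed.

(** Applying the inequality to the inverse scalar gives the converse one. *)
Lemma normc_homogeneous (R : rcfType) (V : lmodType R[i]) (N : V -> R) :
  (forall x, 0 <= N x) ->
  (forall a x, N (a *: x) <= Normc.normc a * N x) ->
  forall a x, N (a *: x) = Normc.normc a * N x.
Proof.
move=> N0 le a x; apply/eqP; rewrite eq_le le /=; have [->|a0] := eqVneq a 0.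
  by rewrite Normc.normc0 mul0r N0.
have := le a^-1 (a *: x); rewrite scalerA mulVf// scale1r => H.
have {}H := ler_wpM2l (normc_ge0 a) H.
by apply: le_trans H _; rewrite mulrA -Normc.normcM mulfV// Normc.normc1 mul1r.
Qed.

Section CStarBasics.
Variables (R : realType) (A : cstarAlgType R).
Implicit Types x y p : A.

Lemma cnorm0 : cnorm (0 : A) = 0.
Proof. by rewrite -(scale0r (0 : A)) cnormZ Normc.normc0 mul0r. Qed.

Lemma cnormN x : cnorm (- x) = cnorm x.
Proof. by rewrite -scaleN1r cnormZ normcN Normc.normc1 mul1r. Qed.

Lemma cnorm_ge0 x : 0 <= cnorm x.
Proof. by have := cnormD x (- x); rewrite subrr cnorm0 cnormN; lra. Qed.

Lemma cnormB x y : cnorm (x - y) = cnorm (y - x).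
Proof. by rewrite -cnormN opprB. Qed.

Lemma cnorm_trans y x z : cnorm (x - z) <= cnorm (x - y) + cnorm (y - z).
Proof. by rewrite (le_trans _ (cnormD _ _))// addrA subrK. Qed.

(** The C*-identity gives |y|^2 <= |y*| |y|, hence |y| <= |y*|, for y = x and for
y = x*. *)
Lemma cnorm_star x : cnorm (star x) = cnorm x.
Proof.
have le_star y : cnorm y <= cnorm (star y).
  have := cnormM (star y) y; rewrite cnorm_starM.
  have := cnorm_ge0 y; have := cnorm_ge0 (star y); nra.
by apply/eqP; rewrite eq_le le_star -{2}(starK x) le_star.
Qed.

Lemma star1 : star (1 : A) = 1.
Proof. by have := starM (star 1) (1 : A); rewrite mulr1 starK mulr1 => <-. Qed.

Lemma cnorm_projection p : star p = p -> p * p = p -> cnorm p <= 1.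
Proof.
move=> ps pp; have := cnorm_starM p; rewrite ps pp.
by have := cnorm_ge0 p; nra.
Qed.

End CStarBasics.

Lemma cvg_to0P (R : realType) (x : nat -> R) : (forall n, 0 <= x n) ->
  (x n @[n --> \oo] --> (0 : R)) <->
  (forall e : R, 0 < e -> exists N, forall n, (N <= n)%N -> x n <= e).
Proof.
move=> x0; split=> [cx e e0|cx].
- have /cvgrPdist_le/(_ e e0) [N _ xN] := cx.
  by exists N => n Nn; have := xN n Nn; rewrite /= sub0r normrN ger0_norm.
- apply/cvgrPdist_le => e e0; have [N xN] := cx e e0.
  by exists N => // n Nn /=; rewrite sub0r normrN ger0_norm// xN.
Qed.

Section Universal.
Variables (R : realType) (G : graph).

Record qut_rep := Rep {
  rep_alg : cstarAlgType R;
  rep_gen : G -> G -> rep_alg;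
  rep_rel : qut_relations rep_gen
}.

Inductive star_poly :=
| SOne
| SGen of G & G
| SAdd of star_poly & star_poly
| SMul of star_poly & star_poly
| SScale of R[i] & star_poly
| SStar of star_poly.

Fixpoint seval (w : qut_rep) (t : star_poly) : rep_alg w :=
  match t with
  | SOne => 1
  | SGen i j => rep_gen w i j
  | SAdd s t => seval w s + seval w t
  | SMul s t => seval w s * seval w t
  | SScale a t => a *: seval w t
  | SStar t => star (seval w t)
  end.

Definition family := forall w : qut_rep, rep_alg w.

Definition approximable (F : family) : Prop :=
  forall e : R, 0 < e -> exists t, forall w, cnorm (seval w t - F w) <= e.

Definition bounded_by (M : R) (F : family) : Prop := forall w, cnorm (F w) <= M.

(** Generators are projections, of norm at most 1, so the bound depends on the
polynomial alone. This is what makes the supremum over all representations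
finite. *)
Lemma seval_bounded t : exists M, bounded_by M (fun w => seval w t).
Proof.
elim: t => [|i j|s [M HM] t [N HN]|s [M HM] t [N HN]|a t [M HM]|t [M HM]].
- by exists 1 => w; apply: cnorm_projection; rewrite /= ?star1 ?mulr1.
- by exists 1 => w; have [rs ri _ _ _] := rep_rel w; apply: cnorm_projection => /=.
- by exists (M + N) => w /=; rewrite (le_trans (cnormD _ _))// lerD.
- exists (M * N) => w /=; rewrite (le_trans (cnormM _ _))//.
  by rewrite ler_pM ?cnorm_ge0.
- exists (Normc.normc a * M) => w /=.
  by rewrite cnormZ ler_wpM2l ?HM ?normc_ge0.
- by exists M => w /=; rewrite cnorm_star.
Qed.

Lemma approximable_bounded F : approximable F -> exists2 M, 0 <= M & bounded_by M F.
Proof.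
move=> /(_ 1 ltr01) [t tF]; have [M HM] := seval_bounded t.
have H w : cnorm (F w) <= M + 1.
  have := cnorm_trans (seval w t) (F w) 0; rewrite !subr0 cnormB => h.
  by have := tF w; have := HM w; lra.
exists `|M + 1| => // w; exact: le_trans (H w) (ler_norm _).
Qed.

Lemma approximable_seval t : approximable (fun w => seval w t).
Proof. by move=> e e0; exists t => w; rewrite subrr cnorm0 ltW. Qed.

Lemma approximableD F F' : approximable F -> approximable F' ->
  approximable (fun w => F w + F' w).
Proof.
move=> aF aF' e e0; have e2 : 0 < e / 2 by lra.
have [s sF] := aF _ e2; have [t tF] := aF' _ e2.
exists (SAdd s t) => w /=; rewrite opprD addrACA (le_trans (cnormD _ _))//.
by have := sF w; have := tF w; lra.
Qed.

Lemma approximableZ a F : approximable F -> approximable (fun w => a *: F w).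
Proof.
move=> aF e e0; have a0 := normc_ge0 a.
have [t tF] := aF (e / (Normc.normc a + 1)) (divr_gt0 e0 (ltr_wpDl a0 ltr01)).
exists (SScale a t) => w /=; rewrite -scalerBr cnormZ.
apply: le_trans (ler_wpM2l a0 (tF w)) _.
rewrite mulrCA ger_pMr// ler_pdivrMr; lra.
Qed.

Lemma approximable_star F : approximable F -> approximable (fun w => star (F w)).
Proof.
move=> aF e e0; have [t tF] := aF e e0; exists (SStar t) => w /=.
have starN (B : cstarAlgType R) (x : B) : star (- x) = - star x.
  by rewrite -scaleN1r starZ rmorphN1 scaleN1r.
by rewrite -starN -starD cnorm_star.
Qed.

Lemma approximableM F F' : approximable F -> approximable F' ->
  approximable (fun w => F w * F' w).
Proof.
move=> aF aF' e e0.
have [M M0 FM] := approximable_bounded aF.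
have M1 : 0 < M + 1 by lra.
have e2 : 0 < e / 2 by lra.
have [t tF'] := aF' (e / 2 / (M + 1)) (divr_gt0 e2 M1).
have [N' HN'] := seval_bounded t; pose N := `|N'| + 1.
have N0 : 0 < N by rewrite /N; have := normr_ge0 N'; lra.
have HN w : cnorm (seval w t) <= N.
  by rewrite /N; have := HN' w; have := ler_norm N'; lra.
have [s sF] := aF (e / 2 / N) (divr_gt0 e2 N0).
exists (SMul s t) => w /=.
have -> : seval w s * seval w t - F w * F' w =
  (seval w s - F w) * seval w t + F w * (seval w t - F' w).
  by rewrite mulrBl mulrBr addrA subrK.
rewrite (le_trans (cnormD _ _))// [e]splitr lerD//.
- apply: le_trans (cnormM _ _) _.
  rewrite (le_trans (ler_pM (cnorm_ge0 _) (cnorm_ge0 _) (sF w) (HN w)))//.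
  by rewrite divfK// gt_eqF.
- apply: le_trans (cnormM _ _) _.
  rewrite (le_trans (ler_pM (cnorm_ge0 _) (cnorm_ge0 _) (FM w) (tF' w)))//.
  by rewrite mulrCA ger_pMr// ler_pdivrMr; lra.
Qed.

Lemma approximable_limit F :
  (forall e : R, 0 < e ->
     exists2 F', approximable F' & forall w, cnorm (F' w - F w) <= e) ->
  approximable F.
Proof.
move=> lF e e0; have e2 : 0 < e / 2 by lra.
have [F' aF' FF'] := lF _ e2; have [t tF'] := aF' _ e2.
exists t => w; apply: le_trans (cnorm_trans (F' w) _ _) _.
by have := FF' w; have := tF' w; lra.
Qed.

(** A family ranges over all representations and so lives in a universe above
that of the algebras in it. An approximable family is determined by the small
set of pairs (t, e) such that the *-polynomial t is uniformly e-close to it; these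
sets are the elements of the universal algebra. *)
Definition code (F : family) : set (star_poly * R) :=
  [set p | forall w, cnorm (seval w p.1 - F w) <= p.2].

Lemma code_inj F F' w : approximable F -> code F = code F' -> F w = F' w.
Proof.
move=> aF cF; apply/eqP; rewrite -subr_eq0; apply/eqP/cnorm_eq0/eqP.
rewrite eq_le cnorm_ge0 andbT; apply/ler_addgt0Pr => e e0; rewrite add0r.
have e2 : 0 < e / 2 by lra.
have [t tF] := aF _ e2.
have tF' : code F' (t, e / 2) by rewrite -cF.
apply: le_trans (cnorm_trans (seval w t) _ _) _; rewrite cnormB.
by have /= := tF' w; have := tF w; lra.
Qed.

Definition CQut : Type :=
  {S : set (star_poly * R) | exists2 F, approximable F & S = code F}.

HB.instance Definition _ := gen_eqMixin CQut.
HB.instance Definition _ := gen_choiceMixin CQut.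

Definition ev (x : CQut) : family := projT1 (cid2 (svalP x)).

Lemma ev_approximable x : approximable (ev x).
Proof. by rewrite /ev; case: cid2. Qed.

Definition mkC F (aF : approximable F) : CQut :=
  exist _ (code F) (ex_intro2 _ _ F aF erefl).

Lemma ev_mkC F (aF : approximable F) w : ev (mkC aF) w = F w.
Proof.
rewrite /ev; case: cid2 => F' aF' /= FF'.
by apply: code_inj aF' _; rewrite FF'.
Qed.

(** All identities of the universal algebra follow by evaluation from the same
identities in the representations. *)
Lemma ev_inj x y : (forall w, ev x w = ev y w) -> x = y.
Proof.
rewrite /ev; case: cid2 => F aF eF; case: cid2 => F' aF' eF' /= FF'.
case: x y eF eF' => [S HS] [S' HS'] /= eF eF'; apply: eq_exist; rewrite eF eF'.
by apply/seteqP; split=> p /= H w; have := H w; rewrite FF'.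
Qed.

Definition CQone := mkC (approximable_seval SOne).
Definition CQgen i j := mkC (approximable_seval (SGen i j)).
Definition CQadd x y := mkC (approximableD (ev_approximable x) (ev_approximable y)).
Definition CQmul x y := mkC (approximableM (ev_approximable x) (ev_approximable y)).
Definition CQscale a x := mkC (approximableZ a (ev_approximable x)).
Definition CQstar x := mkC (approximable_star (ev_approximable x)).

Let evE := (ev_mkC).

Fact CQaddA : associative CQadd.
Proof. by move=> x y z; apply: ev_inj => w; rewrite !evE addrA. Qed.
Fact CQaddC : commutative CQadd.
Proof. by move=> x y; apply: ev_inj => w; rewrite !evE addrC. Qed.
Fact CQadd0 : left_id (CQscale 0 CQone) CQadd.
Proof. by move=> x; apply: ev_inj => w; rewrite !evE scale0r add0r. Qed.
Fact CQaddN : left_inverse (CQscale 0 CQone) (CQscale (-1)) CQadd.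
Proof. by move=> x; apply: ev_inj => w; rewrite !evE scale0r scaleN1r addNr. Qed.
HB.instance Definition _ :=
  GRing.isZmodule.Build CQut CQaddA CQaddC CQadd0 CQaddN.

Lemma evD x y w : ev (x + y) w = ev x w + ev y w. Proof. exact: evE. Qed.
Lemma ev0 w : ev 0 w = 0. Proof. by rewrite evE scale0r. Qed.

Fact CQmulA : associative CQmul.
Proof. by move=> x y z; apply: ev_inj => w; rewrite !evE mulrA. Qed.
Fact CQmul1r : left_id CQone CQmul.
Proof. by move=> x; apply: ev_inj => w; rewrite !evE mul1r. Qed.
Fact CQmulr1 : right_id CQone CQmul.
Proof. by move=> x; apply: ev_inj => w; rewrite !evE mulr1. Qed.
Fact CQmulDl : left_distributive CQmul +%R.
Proof. by move=> x y z; apply: ev_inj => w; rewrite !evE mulrDl. Qed.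
Fact CQmulDr : right_distributive CQmul +%R.
Proof. by move=> x y z; apply: ev_inj => w; rewrite !evE mulrDr. Qed.
HB.instance Definition _ := GRing.Zmodule_isPzRing.Build CQut
  CQmulA CQmul1r CQmulr1 CQmulDl CQmulDr.

Lemma evM x y w : ev (x * y) w = ev x w * ev y w. Proof. exact: evE. Qed.
Lemma ev1 w : ev 1 w = 1. Proof. exact: evE. Qed.

Fact CQscaleA a b x : CQscale a (CQscale b x) = CQscale (a * b) x.
Proof. by apply: ev_inj => w; rewrite !evE scalerA. Qed.
Fact CQscale1 : left_id 1 CQscale.
Proof. by move=> x; apply: ev_inj => w; rewrite !evE scale1r. Qed.
Fact CQscaleDr : right_distributive CQscale +%R.
Proof. by move=> a x y; apply: ev_inj => w; rewrite !evE scalerDr. Qed.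
Fact CQscaleDl x : {morph CQscale^~ x : a b / a + b}.
Proof. by move=> a b; apply: ev_inj => w; rewrite !evE scalerDl. Qed.
HB.instance Definition _ := GRing.Zmodule_isLmodule.Build R[i] CQut
  CQscaleA CQscale1 CQscaleDr CQscaleDl.

Lemma evZ a x w : ev (a *: x) w = a *: ev x w. Proof. exact: evE. Qed.

(** The point evaluation at the identity automorphism. It shows that the universal
algebra is not zero. *)
Lemma trivial_relations : @qut_relations R G R[i]^o (fun i j => (i == j)%:R).
Proof.
split=> [i j|i j|i|i|i j k l] /=.
- exact: rmorph_nat.
- by rewrite -natrM mulnb andbb.
- by rewrite (bigD1 i)//= eqxx big1 ?addr0// => j /negPf ji; rewrite eq_sym ji.
- by rewrite (bigD1 i)//= eqxx big1 ?addr0// => j /negPf ->.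
- case: (eqVneq i j) => [->|_]; last by rewrite mul0r.
  by case: (eqVneq k l) => [->|_]; rewrite ?mulr0// eqxx.
Qed.

Definition trivial_rep := Rep trivial_relations.

Fact CQone_neq0 : CQone != 0.
Proof.
apply/eqP => /(congr1 (fun x => ev x trivial_rep)); rewrite ev1 ev0.
by apply/eqP; exact: (@oner_neq0 R[i]).
Qed.
HB.instance Definition _ := GRing.PzSemiRing_isNonZero.Build CQut CQone_neq0.

Fact CQscaleAl (a : R[i]) (x y : CQut) : a *: (x * y) = a *: x * y.
Proof. by apply: ev_inj => w; rewrite !(evZ, evM) scalerAl. Qed.
HB.instance Definition _ :=
  GRing.LSemiModule_isLSemiAlgebra.Build R[i] CQut CQscaleAl.
Fact CQscaleAr (a : R[i]) (x y : CQut) : a *: (x * y) = x * (a *: y).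
Proof. by apply: ev_inj => w; rewrite !(evZ, evM) scalerAr. Qed.
HB.instance Definition _ := GRing.Lalgebra_isAlgebra.Build R[i] CQut CQscaleAr.

Lemma evN x w : ev (- x) w = - ev x w. Proof. by rewrite -scaleN1r evZ scaleN1r. Qed.
Lemma evB x y w : ev (x - y) w = ev x w - ev y w. Proof. by rewrite evD evN. Qed.

Lemma ev_star x w : ev (CQstar x) w = star (ev x w). Proof. exact: evE. Qed.

Definition CQnorms (x : CQut) : set R := [set r | exists w, r = cnorm (ev x w)].

Definition CQnorm (x : CQut) : R := sup (CQnorms x).

Lemma CQnorm_has_sup x : has_sup (CQnorms x).
Proof.
split; first by exists (cnorm (ev x trivial_rep)), trivial_rep.
have [M _ HM] := approximable_bounded (@ev_approximable x).
by exists M => _ [w ->].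
Qed.

Lemma ev_le_norm x w : cnorm (ev x w) <= CQnorm x.
Proof. by apply: (ub_le_sup (CQnorm_has_sup x).2); exists w. Qed.

Lemma CQnorm_le x (c : R) : (forall w, cnorm (ev x w) <= c) -> CQnorm x <= c.
Proof.
move=> xc; apply: ge_sup; first exact: (CQnorm_has_sup x).1.
by move=> _ [w ->].
Qed.

Lemma CQnorm_ge0 x : 0 <= CQnorm x.
Proof. exact: le_trans (cnorm_ge0 _) (ev_le_norm x trivial_rep). Qed.

Fact CQstarK : involutive CQstar.
Proof. by move=> x; apply: ev_inj => w; rewrite !evE starK. Qed.
Fact CQstarD : {morph CQstar : x y / x + y}.
Proof. by move=> x y; apply: ev_inj => w; rewrite !evE starD. Qed.
Fact CQstarZ (a : R[i]) (x : CQut) : CQstar (a *: x) = a^* *: CQstar x.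
Proof. by apply: ev_inj => w; rewrite !evE starZ. Qed.
Fact CQstarM (x y : CQut) : CQstar (x * y) = CQstar y * CQstar x.
Proof. by apply: ev_inj => w; rewrite !evE starM. Qed.

Fact CQnorm_eq0 x : CQnorm x = 0 -> x = 0.
Proof.
move=> x0; apply: ev_inj => w; rewrite ev0; apply: cnorm_eq0.
by apply/eqP; rewrite eq_le cnorm_ge0 andbT -x0 ev_le_norm.
Qed.

Fact CQnormD (x y : CQut) : CQnorm (x + y) <= CQnorm x + CQnorm y.
Proof.
apply: CQnorm_le => w; rewrite evD (le_trans (cnormD _ _))//.
by rewrite lerD ?ev_le_norm.
Qed.

Fact CQnormZ (a : R[i]) (x : CQut) : CQnorm (a *: x) = Normc.normc a * CQnorm x.
Proof.
apply: normc_homogeneous => [|b y]; first exact: CQnorm_ge0.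
by apply: CQnorm_le => w; rewrite evZ cnormZ ler_wpM2l ?normc_ge0 ?ev_le_norm.
Qed.

Fact CQnormM (x y : CQut) : CQnorm (x * y) <= CQnorm x * CQnorm y.
Proof.
apply: CQnorm_le => w; rewrite evM (le_trans (cnormM _ _))//.
by rewrite ler_pM ?cnorm_ge0 ?ev_le_norm.
Qed.

Fact CQnorm_starM (x : CQut) : CQnorm (CQstar x * x) = CQnorm x ^+ 2.
Proof.
apply/eqP; rewrite eq_le; apply/andP; split.
  apply: CQnorm_le => w; rewrite evM ev_star cnorm_starM.
  by rewrite lerXn2r ?nnegrE ?cnorm_ge0 ?CQnorm_ge0 ?ev_le_norm.
have s0 := CQnorm_ge0 (CQstar x * x).
rewrite -[leRHS]sqr_sqrtr// lerXn2r ?nnegrE ?sqrtr_ge0 ?CQnorm_ge0//.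
apply: CQnorm_le => w; rewrite -[leLHS]ger0_norm ?cnorm_ge0// -sqrtr_sqr.
by rewrite ler_wsqrtr// -cnorm_starM -ev_star -evM ev_le_norm.
Qed.

(** A Cauchy sequence converges in every representation, uniformly over the
representations, so that its limit is again approximable. *)
Fact CQnorm_complete (x : nat -> CQut) :
  (forall e : R, 0 < e ->
     exists N, forall m n, (N <= m)%N -> (N <= n)%N -> CQnorm (x m - x n) < e) ->
  exists l : CQut, CQnorm (x n - l) @[n --> \oo] --> (0 : R).
Proof.
move=> xC.
have lim w : exists l, cnorm (ev (x n) w - l) @[n --> \oo] --> (0 : R).
  apply: cnorm_complete => e /xC[N xN]; exists N => m n Nm Nn.
  by rewrite -evB (le_lt_trans (ev_le_norm _ _)) ?xN.
pose L : family := fun w => projT1 (cid (lim w)).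
have LP w (e : R) : 0 < e ->
    exists N, forall n, (N <= n)%N -> cnorm (ev (x n) w - L w) <= e.
  rewrite /L; case: cid => l /= lP; apply: (cvg_to0P _).1 lP e => n.
  exact: cnorm_ge0.
(* the index supplied by the Cauchy property does not depend on w, unlike that
   of the convergence at w *)
have unif e : 0 < e -> exists N, forall n, (N <= n)%N ->
    forall w, cnorm (ev (x n) w - L w) <= e.
  move=> e0; have e2 : 0 < e / 2 by lra.
  have [N xN] := xC _ e2; exists N => n Nn w.
  have [N' xN'] := LP w _ e2; pose m := maxn N N'.
  have := xN' m (leq_maxr _ _); have := xN n m Nn (leq_maxl _ _).
  have := ev_le_norm (x n - x m) w; rewrite evB.
  have := cnorm_trans (ev (x m) w) (ev (x n) w) (L w); lra.
have aL : approximable L.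
  apply: approximable_limit => e /unif[N xN].
  by exists (ev (x N)); [exact: ev_approximable | exact: xN].
exists (mkC aL); apply/cvg_to0P => [n|e /unif[N xN]]; first exact: CQnorm_ge0.
by exists N => n Nn; apply: CQnorm_le => w; rewrite evB evE xN.
Qed.

HB.instance Definition _ := @isCStarAlgebra.Build R CQut CQstar
  CQstarK CQstarD CQstarZ CQstarM CQnorm CQnorm_eq0 CQnormD CQnormZ CQnormM
  CQnorm_starM CQnorm_complete.

Lemma CQut_relations : qut_relations (CQgen : G -> G -> CQut).
Proof.
have ev_sum (I : finType) (F : I -> CQut) w :
    ev (\sum_i F i) w = \sum_i ev (F i) w.
  exact: (big_morph (fun x => ev x w) (fun x y => evD x y w) (ev0 w)).
split=> [i j|i j|i|i|i j k l ijkl]; apply: ev_inj => w;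
  have [rs ri rr rc re] := rep_rel w.
- by rewrite ev_star evE /= rs.
- by rewrite evM evE /= ri.
- by rewrite ev_sum ev1 -[RHS](rr i); apply: eq_bigr => l _; rewrite evE.
- by rewrite ev_sum ev1 -[RHS](rc i); apply: eq_bigr => l _; rewrite evE.
- by rewrite evM ev0 !evE /= re.
Qed.

Lemma CQut_generated : cstar_generated [set CQgen p.1 p.2 | p in [set: G * G]].
Proof.
move=> B Bgen B1 BD BM BZ Bstar Blim; apply/seteqP; split=> // x _.
have Bpoly t : B (mkC (approximable_seval t)).
  elim: t => [|i j|s Bs t Bt|s Bs t Bt|a t Bt|t Bt].
  - exact: B1.
  - by apply: Bgen; exists (i, j).
  - by have := BD _ _ Bs Bt; congr B; apply: ev_inj => w; rewrite evD !evE.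
  - by have := BM _ _ Bs Bt; congr B; apply: ev_inj => w; rewrite evM !evE.
  - by have := BZ a _ Bt; congr B; apply: ev_inj => w; rewrite evZ !evE.
  - by have := Bstar _ Bt; congr B; apply: ev_inj => w; rewrite ev_star !evE.
have inv0 n : 0 < n.+1%:R^-1 :> R by rewrite invr_gt0 ltr0n.
pose t n := projT1 (cid (ev_approximable x (inv0 n))).
have tP n w : cnorm (seval w (t n) - ev x w) <= n.+1%:R^-1.
  by rewrite /t; case: cid.
apply: (Blim (fun n => mkC (approximable_seval (t n)))) => //.
apply/cvg_to0P => [n|e e0]; first exact: cnorm_ge0.
have [N eN] : exists N : nat, e^-1 <= N%:R.
  by exists (Num.bound e^-1); rewrite ltW// archi_boundP// invr_ge0 ltW.
exists N => n Nn; apply: CQnorm_le => w; rewrite evB evE (le_trans (tP n w))//.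
rewrite -[e]invrK lef_pV2 ?posrE ?invr_gt0 ?ltr0n// (le_trans eN)// ler_nat.
exact: leqW.
Qed.

Section Evaluation.
Variable w : qut_rep.

Definition evw (x : CQut) : rep_alg w := ev x w.

Fact evw_scalable : scalable evw. Proof. by move=> a x; exact: evZ. Qed.
Fact evw_additive : nmod_morphism evw.
Proof. by split=> [|x y]; [exact: ev0 | exact: evD]. Qed.
Fact evw_monoid : monoid_morphism evw.
Proof. by split=> [|x y]; [exact: ev1 | exact: evM]. Qed.

HB.instance Definition _ :=
  GRing.isNmodMorphism.Build CQut (rep_alg w) evw evw_additive.
HB.instance Definition _ :=
  GRing.isMonoidMorphism.Build CQut (rep_alg w) evw evw_monoid.
HB.instance Definition _ :=
  GRing.isScalable.Build R[i] CQut (rep_alg w) *:%R evw evw_scalable.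

End Evaluation.

Theorem CQut_is_CQut : is_CQut CQgen.
Proof.
split; [exact: CQut_relations | exact: CQut_generated |].
move=> B v rv; exists (evw (Rep rv) : {lrmorphism CQut -> rep_alg (Rep rv)}) => [x|i j].
  exact: (ev_star x (Rep rv)).
exact: (evE (approximable_seval (SGen i j)) (Rep rv)).
Qed.

End Universal.

(** An isomorphism with the complex numbers would send the generator (i, j), which
is a projection, to 0 or 1; by injectivity it would then be 0 or 1 in the
universal algebra, and therefore in every representation. *)
Lemma nontrivial_Qut (R : realType) (G : graph) (B : cstarAlgType R)
    (v : G -> G -> B) (i j : G) :
  qut_relations v -> v i j != 0 -> v i j != 1 -> ~ Qut_trivial R G.
Proof.
move=> rv v0 v1 /(_ _ _ (CQut_is_CQut R G))[f _ /bij_inj finj].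
have evv : ev (CQgen R i j) (Rep rv) = v i j by exact: ev_mkC.
have ff : f (CQgen R i j) * (f (CQgen R i j) - 1) = 0 :> R[i].
  rewrite mulrBr mulr1; apply/eqP; rewrite subr_eq0 -[X in X == _]rmorphM.
  by rewrite (qut_idem (CQut_relations R G)).
have /eqP := ff; rewrite mulf_eq0 subr_eq0 => /orP[]/eqP f01.
- have u0 : CQgen R i j = 0 by apply: finj; rewrite rmorph0.
  by move: v0; rewrite -evv u0 ev0 eqxx.
- have u1 : CQgen R i j = 1 by apply: finj; rewrite rmorph1.
  by move: v1; rewrite -evv u1 ev1 eqxx.
Qed.

(** * Complex matrices as a C*-algebra *)

Section MatrixCStar.
Variable R : realType.
Local Notation C := R[i].

Definition adjmx m n (A : 'M[C]_(m, n)) : 'M[C]_(n, m) := map_mx (@conjc R) A^T.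

Lemma adjmxK m n : cancel (@adjmx m n) (@adjmx n m).
Proof. by move=> A; apply/matrixP=> i j; rewrite !mxE conjcK. Qed.

Lemma adjmxD m n : {morph @adjmx m n : A B / A + B}.
Proof. by move=> A B; apply/matrixP=> i j; rewrite !mxE rmorphD. Qed.

Lemma adjmxZ m n (a : C) (A : 'M[C]_(m, n)) : adjmx (a *: A) = a^* *: adjmx A.
Proof. by apply/matrixP=> i j; rewrite !mxE rmorphM. Qed.

Lemma adjmxM m n p (A : 'M[C]_(m, n)) (B : 'M[C]_(n, p)) :
  adjmx (A *m B) = adjmx B *m adjmx A.
Proof. by rewrite /adjmx trmx_mul map_mxM. Qed.

Section Vectors.
Variable n : nat.
Implicit Types x y z : 'cV[C]_n.

(** The real part of the Hermitian product is enough: it induces the same norm and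
the same adjoint, and it is symmetric. *)
Definition rdot x y : R := complex.Re ((adjmx x *m y) 0 0).

Lemma rdotE x y : rdot x y =
  \sum_i (complex.Re (x i 0) * complex.Re (y i 0) +
          complex.Im (x i 0) * complex.Im (y i 0)).
Proof.
rewrite /rdot mxE raddf_sum; apply: eq_bigr => i _; rewrite !mxE.
by case: (x i 0) (y i 0) => a b [c d] /=; rewrite mulNr opprK.
Qed.

Lemma rdotC x y : rdot x y = rdot y x.
Proof. by rewrite !rdotE; apply: eq_bigr => i _; ring. Qed.

Lemma rdotDr x y z : rdot x (y + z) = rdot x y + rdot x z.
Proof. by rewrite /rdot mulmxDr mxE raddfD. Qed.

Lemma rdotZr (a : R) x y : rdot x (a%:C *: y) = a * rdot x y.
Proof.
by rewrite /rdot -scalemxAr mxE; case: (_ 0 0) => u v /=; rewrite mul0r subr0.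
Qed.

Lemma rdotxx x : rdot x x = \sum_i Normc.normc (x i 0) ^+ 2.
Proof.
rewrite rdotE; apply: eq_bigr => i _; case: (x i 0) => a b /=.
by rewrite sqr_sqrtr ?addr_ge0 ?sqr_ge0// !expr2.
Qed.

Lemma rdot_ge0 x : 0 <= rdot x x.
Proof. by rewrite rdotxx sumr_ge0// => i _; rewrite sqr_ge0. Qed.

Definition l2norm x : R := Num.sqrt (rdot x x).

Lemma l2norm_ge0 x : 0 <= l2norm x. Proof. exact: sqrtr_ge0. Qed.

Lemma sqr_l2norm x : l2norm x ^+ 2 = rdot x x.
Proof. by rewrite sqr_sqrtr ?rdot_ge0. Qed.

Lemma normc_le_l2norm x i : Normc.normc (x i 0) <= l2norm x.
Proof.
rewrite -[leLHS]ger0_norm ?normc_ge0// -sqrtr_sqr ler_wsqrtr// rdotxx.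
by rewrite (bigD1 i)//= lerDl sumr_ge0// => j _; rewrite sqr_ge0.
Qed.

Lemma l2norm_le_sum x : l2norm x <= \sum_i Normc.normc (x i 0).
Proof.
have S0 : 0 <= \sum_i Normc.normc (x i 0) by apply: sumr_ge0 => i _; exact: normc_ge0.
rewrite -[leRHS]ger0_norm// -sqrtr_sqr ler_wsqrtr// rdotxx expr2 mulr_suml.
apply: ler_sum => i _; rewrite expr2 ler_wpM2l ?normc_ge0// (bigD1 i)//= lerDl.
by rewrite sumr_ge0// => j _; exact: normc_ge0.
Qed.

Lemma l2norm_eq0 x : l2norm x = 0 -> x = 0.
Proof.
move=> x0; apply/matrixP=> i j; rewrite ord1 mxE; apply: Normc.eq0_normc.
by apply/eqP; rewrite eq_le normc_ge0 andbT -x0 normc_le_l2norm.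
Qed.

Lemma l2normZ (a : C) x : l2norm (a *: x) = Normc.normc a * l2norm x.
Proof.
rewrite /l2norm !rdotxx; under eq_bigr do rewrite mxE Normc.normcM exprMn.
by rewrite -mulr_sumr sqrtrM ?sqr_ge0// sqrtr_sqr ger0_norm ?normc_ge0.
Qed.

Lemma rdot_expand (s : R) x y :
  rdot (x + s%:C *: y) (x + s%:C *: y) =
  rdot x x + 2 * s * rdot x y + s ^+ 2 * rdot y y.
Proof.
rewrite rdotDr rdotZr ![rdot (_ + _) _]rdotC !rdotDr !rdotZr (rdotC y x); ring.
Qed.

(** Cauchy-Schwarz, from the sign of the squared length of x + s y at the value
of s that minimizes it. *)
Lemma rdot_le x y : rdot x y <= l2norm x * l2norm y.
Proof.
have [y0|y0] := eqVneq (rdot y y) 0.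
  have /l2norm_eq0 -> : l2norm y = 0 by rewrite /l2norm y0 sqrtr0.
  by rewrite /rdot mulmx0 mxE mulr_ge0 ?l2norm_ge0.
have {}y0 : 0 < rdot y y by rewrite lt_def y0 rdot_ge0.
have := rdot_ge0 (x + (- (rdot x y / rdot y y))%:C *: y); rewrite rdot_expand.
have -> : rdot x x + 2 * - (rdot x y / rdot y y) * rdot x y +
    (- (rdot x y / rdot y y)) ^+ 2 * rdot y y =
    (rdot x x * rdot y y - rdot x y ^+ 2) / rdot y y.
  by field; rewrite gt_eqF.
rewrite pmulr_lge0 ?invr_gt0// subr_ge0 => h.
apply: le_trans (ler_norm _) _.
rewrite -sqrtr_sqr /l2norm -sqrtrM ?rdot_ge0//; exact: ler_wsqrtr.
Qed.

Lemma l2normD x y : l2norm (x + y) <= l2norm x + l2norm y.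
Proof.
have h0 : 0 <= l2norm x + l2norm y by rewrite addr_ge0 ?l2norm_ge0.
rewrite -(ler_pXn2r (_ : 0 < 2)%N) ?nnegrE ?l2norm_ge0// sqr_l2norm.
have := rdot_expand 1 x y; rewrite scale1r => ->.
rewrite -!sqr_l2norm; have := rdot_le x y; nra.
Qed.

End Vectors.

Lemma rdot_adj m n (A : 'M[C]_(m, n)) x y : rdot (A *m x) y = rdot x (adjmx A *m y).
Proof. by rewrite /rdot adjmxM mulmxA. Qed.

Section Operators.
Variable n : nat.
Implicit Types A B : 'M[C]_n.

Definition opbound A (c : R) :=
  0 <= c /\ forall x : 'cV[C]_n, l2norm (A *m x) <= c * l2norm x.

(** As an infimum of bounds, the norm is estimated from above by exhibiting a
bound; the infimum is attained by [opbound_opnorm]. *)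
Definition opnorm A : R := inf [set c | opbound A c].

Definition entrysum A : R := \sum_i \sum_j Normc.normc (A i j).

Lemma normc_sum (I : finType) (F : I -> C) :
  Normc.normc (\sum_i F i) <= \sum_i Normc.normc (F i).
Proof.
elim/big_ind2 : _ => [|u s v t us vt|//]; first by rewrite Normc.normc0.
by apply: le_trans (@cnormD R C^o _ _) _; rewrite lerD.
Qed.

Lemma opbound_entrysum A : opbound A (entrysum A).
Proof.
have s0 : 0 <= entrysum A.
  by apply: sumr_ge0 => i _; apply: sumr_ge0 => j _; exact: normc_ge0.
split=> // x; apply: le_trans (l2norm_le_sum _) _.
rewrite mulr_suml; apply: ler_sum => i _; rewrite mxE mulr_suml.
apply: le_trans (normc_sum _) _; apply: ler_sum => j _.
by rewrite Normc.normcM ler_wpM2l ?normc_ge0// normc_le_l2norm.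
Qed.

Lemma opnorm_le A c : opbound A c -> opnorm A <= c.
Proof. by move=> Ac; apply: ge_inf => //; exists 0 => d []. Qed.

Lemma le_opnorm A d : (forall c, opbound A c -> d <= c) -> d <= opnorm A.
Proof.
by move=> H; apply: lb_le_inf; [exists (entrysum A); exact: opbound_entrysum|].
Qed.

Lemma opbound_opnorm A : opbound A (opnorm A).
Proof.
split=> [|x]; first by apply: le_opnorm => c [].
have [x0|x0] := eqVneq (l2norm x) 0.
  by have [_ /(_ x)] := opbound_entrysum A; rewrite x0 !mulr0.
have {}x0 : 0 < l2norm x by rewrite lt_def x0 l2norm_ge0.
rewrite -ler_pdivrMr//; apply: le_opnorm => c [_ /(_ x)].
by rewrite ler_pdivrMr.
Qed.

Lemma opnorm_ge0 A : 0 <= opnorm A. Proof. exact: (opbound_opnorm A).1. Qed.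

Lemma l2norm_opnorm A x : l2norm (A *m x) <= opnorm A * l2norm x.
Proof. exact: (opbound_opnorm A).2. Qed.

Lemma normc_le_opnorm A i j : Normc.normc (A i j) <= opnorm A.
Proof.
have e1 : l2norm (delta_mx j 0 : 'cV[C]_n) = 1.
  rewrite /l2norm rdotxx (bigD1 j)//= mxE !eqxx Normc.normc1 expr1n.
  rewrite big1 ?addr0 ?sqrtr1// => k /negPf kj.
  by rewrite mxE kj Normc.normc0 expr0n.
have := l2norm_opnorm A (delta_mx j 0); rewrite e1 mulr1 -colE => h.
by apply: le_trans h; have := normc_le_l2norm (col j A) i; rewrite mxE.
Qed.

Lemma opnorm_eq0 A : opnorm A = 0 -> A = 0.
Proof.
move=> A0; apply/matrixP=> i j; rewrite mxE; apply: Normc.eq0_normc.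
by apply/eqP; rewrite eq_le normc_ge0 andbT -A0 normc_le_opnorm.
Qed.

Lemma opnormD A B : opnorm (A + B) <= opnorm A + opnorm B.
Proof.
apply: opnorm_le; split=> [|x]; first by rewrite addr_ge0 ?opnorm_ge0.
rewrite mulmxDl mulrDl (le_trans (l2normD _ _))// lerD// ?l2norm_opnorm//.
Qed.

Lemma opnormM A B : opnorm (A *m B) <= opnorm A * opnorm B.
Proof.
apply: opnorm_le; split=> [|x]; first by rewrite mulr_ge0 ?opnorm_ge0.
rewrite -mulmxA (le_trans (l2norm_opnorm _ _))// -mulrA.
by rewrite ler_wpM2l ?opnorm_ge0 ?l2norm_opnorm.
Qed.

Lemma opnormZ (a : C) A : opnorm (a *: A) = Normc.normc a * opnorm A.
Proof.
apply: normc_homogeneous => [|b B]; first exact: opnorm_ge0.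
apply: opnorm_le; split=> [|x]; first by rewrite mulr_ge0 ?normc_ge0 ?opnorm_ge0.
by rewrite -scalemxAl l2normZ -mulrA ler_wpM2l ?normc_ge0 ?l2norm_opnorm.
Qed.

(** |A* x|^2 = <A A* x, x> <= |A| |A* x| |x|. *)
Lemma opnorm_adj_le A : opnorm (adjmx A) <= opnorm A.
Proof.
apply: opnorm_le; split=> [|x]; first exact: opnorm_ge0.
have /le_trans := rdot_le (A *m (adjmx A *m x)) x.
move=> /(_ _ (ler_wpM2r (l2norm_ge0 x) (l2norm_opnorm _ _))).
rewrite rdot_adj -sqr_l2norm.
have := l2norm_ge0 (adjmx A *m x); have := l2norm_ge0 x; have := opnorm_ge0 A.
move: (opnorm A) (l2norm x) (l2norm (adjmx A *m x)) => a u v a0 u0 v0 h.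
have [v1|v1] := ltP 0 v; last by have := mulr_ge0 a0 u0; lra.
have {}h : v * v <= v * (a * u) by lra.
by rewrite -(ler_pM2l v1).
Qed.

(** The nontrivial half is |A x|^2 = <A* A x, x> <= |A* A| |x|^2. *)
Lemma opnorm_starM A : opnorm (adjmx A *m A) = opnorm A ^+ 2.
Proof.
apply/eqP; rewrite eq_le; apply/andP; split.
  rewrite (le_trans (opnormM _ _))// expr2.
  by rewrite ler_wpM2r ?opnorm_ge0 ?opnorm_adj_le.
have s0 := opnorm_ge0 (adjmx A *m A).
rewrite -[leRHS]sqr_sqrtr// lerXn2r ?nnegrE ?sqrtr_ge0 ?opnorm_ge0//.
apply: opnorm_le; split=> [|x]; first exact: sqrtr_ge0.
rewrite -[l2norm x]ger0_norm ?l2norm_ge0// -sqrtr_sqr -sqrtrM// ler_wsqrtr//.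
rewrite rdot_adj rdotC (le_trans (rdot_le _ _))// mulmxA.
by rewrite expr2 mulrA ler_wpM2r ?l2norm_ge0 ?l2norm_opnorm.
Qed.

Lemma opnorm_complete (x : nat -> 'M[C]_n) :
  (forall e : R, 0 < e ->
     exists N, forall m p, (N <= m)%N -> (N <= p)%N -> opnorm (x m - x p) < e) ->
  exists l, opnorm (x p - l) @[p --> \oo] --> (0 : R).
Proof.
move=> xC.
have lim i j : exists l : C, Normc.normc (x p i j - l) @[p --> \oo] --> (0 : R).
  apply: (@cnorm_complete R C^o) => e /xC[N xN]; exists N => m p Nm Np.
  have := normc_le_opnorm (x m - x p) i j; rewrite !mxE => h.
  exact: le_lt_trans h (xN _ _ Nm Np).
pose L := \matrix_(i, j) projT1 (cid (lim i j)).
exists L; apply: (@squeeze_cvgr _ _ _ _ (fun=> 0) (fun p => entrysum (x p - L))).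
- by apply: nearW => p; rewrite opnorm_ge0 opnorm_le//; exact: opbound_entrysum.
- exact: cvg_cst.
- have -> : (0 : R) = \sum_(i < n) \sum_(j < n) 0.
    by rewrite big1// => i _; rewrite big1.
  apply: cvg_big => [|i _]; first exact: add_continuous.
  apply: cvg_big => [|j _]; first exact: add_continuous.
  under eq_fun do rewrite !mxE.
  by case: cid.
Qed.

End Operators.

Variable n : nat.

HB.instance Definition _ := @isCStarAlgebra.Build R 'M[C]_n.+1 (@adjmx n.+1 n.+1)
  (@adjmxK n.+1 n.+1) (@adjmxD n.+1 n.+1) (@adjmxZ n.+1 n.+1) (@adjmxM n.+1 n.+1 n.+1)
  (@opnorm n.+1) (@opnorm_eq0 n.+1) (@opnormD n.+1) (@opnormZ n.+1)
  (@opnormM n.+1) (@opnorm_starM n.+1) (@opnorm_complete n.+1).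

End MatrixCStar.

(** * The graph of a system of equations over F_2 *)

(** The equation k reads f (var1 k) + f (var2 k) = f (var3 k). The variables of an
equation are listed in increasing order, so that two equations with the same set
of variables are equal; otherwise their local solutions would be twins in the
graph, and exchanging twins is an automorphism. *)
Record xor_system := XorSystem {
  var : finType;
  con : finType;
  var1 : con -> var;
  var2 : con -> var;
  var3 : con -> var;
  var_sorted : forall k,
    (enum_rank (var1 k) < enum_rank (var2 k) < enum_rank (var3 k))%N;
  con_inj : forall k k', var1 k = var1 k' -> var2 k = var2 k' -> k = k'
}.

Section SystemGraph.
Variable S : xor_system.
Local Notation I := (var S).
Local Notation K := (con S).
Local Open Scope nat_scope.

Definition system_vertex : finType := ((I + I * bool) + K * (bool * bool))%type.

(** A local solution (k, s, t) assigns s, t and s + t to the variables of k. *)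
Definition anchor (j : I) : system_vertex := inl (inl j).
Definition literal (i : I) (e : bool) : system_vertex := inl (inr (i, e)).
Definition local_sol (k : K) (s t : bool) : system_vertex := inr (k, (s, t)).

Definition agree (i : I) (e : bool) (k : K) (s t : bool) : bool :=
  [|| (i == var1 k) && (e == s), (i == var2 k) && (e == t)
    | (i == var3 k) && (e == s (+) t)].

(** The anchors adjacent to a literal are those larger than its variable: they
determine the variable, and they are never all the anchors, which distinguishes
literals from local solutions. *)
Definition system_edge (v w : system_vertex) : bool :=
  match v, w with
  | inl (inl j), inl (inl j') => j != j'
  | inl (inl j), inl (inr (i, _)) => enum_rank i < enum_rank j
  | inl (inr (i, _)), inl (inl j) => enum_rank i < enum_rank j
  | inl (inl _), inr _ => true
  | inr _, inl (inl _) => true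
  | inl (inr (i, e)), inr (k, (s, t)) => agree i e k s t
  | inr (k, (s, t)), inl (inr (i, e)) => agree i e k s t
  | _, _ => false
  end.

Lemma system_edge_sym : symmetric system_edge.
Proof.
by move=> [[j|[i e]]|[k [s t]]] [[j'|[i' e']]|[k' [s' t']]] //=; rewrite eq_sym.
Qed.

Lemma system_edge_irr : irreflexive system_edge.
Proof. by move=> [[j|[i e]]|[k [s t]]] //=; rewrite eqxx. Qed.

Definition system_graph : graph := Graph system_edge_sym system_edge_irr.

Lemma var12 (k : K) : var1 k != var2 k.
Proof. by apply/eqP => h; have /andP[] := var_sorted k; rewrite h ltnn. Qed.
Lemma var23 (k : K) : var2 k != var3 k.
Proof. by apply/eqP => h; have /andP[] := var_sorted k; rewrite h ltnn. Qed.
Lemma var13 (k : K) : var1 k != var3 k.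
Proof.
apply/eqP => h; have /andP[h1 h2] := var_sorted k.
by have := ltn_trans h1 h2; rewrite h ltnn.
Qed.

Lemma agree1 e (k : K) s t : agree (var1 k) e k s t = (e == s).
Proof. by rewrite /agree eqxx (negPf (var12 k)) (negPf (var13 k)) /= orbF. Qed.
Lemma agree2 e (k : K) s t : agree (var2 k) e k s t = (e == t).
Proof. by rewrite /agree eqxx eq_sym (negPf (var12 k)) (negPf (var23 k)) /= orbF. Qed.
Lemma agree3 e (k : K) s t : agree (var3 k) e k s t = (e == s (+) t).
Proof.
by rewrite /agree eqxx ![var3 k == _]eq_sym (negPf (var13 k)) (negPf (var23 k)).
Qed.

Variant vars_spec (k : K) (i : I) : Prop :=
| IsVar1 of i = var1 k | IsVar2 of i = var2 k | IsVar3 of i = var3 k.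

Lemma agree_vars i e k s t : agree i e k s t -> vars_spec k i.
Proof.
by case/or3P => /andP[/eqP -> _]; [exact: IsVar1 | exact: IsVar2 | exact: IsVar3].
Qed.

Lemma vars_con_inj (k k' : K) :
  vars_spec k' (var1 k) -> vars_spec k' (var2 k) -> vars_spec k' (var3 k) -> k = k'.
Proof.
have /andP[h1 h2] := var_sorted k; have /andP[h1' h2'] := var_sorted k'.
by move=> [] e1 [] e2 [] e3; try exact: con_inj;
  rewrite e1 ?e2 ?e3 in h1 h2; rewrite ?e2 ?e3 in h1 h2; exfalso; lia.
Qed.

Definition degree (v : system_vertex) : nat := \sum_w system_edge v w.

Definition below (j : I) : nat := #|[pred i : I | enum_rank i < enum_rank j]|.

Lemma below_lt j j' : enum_rank j < enum_rank j' -> below j < below j'.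
Proof.
move=> jj'; apply/proper_card/fintype.properP; split.
  by apply/fintype.subsetP => i; rewrite !inE => /ltn_trans; exact.
by exists j; rewrite !inE ?ltnn.
Qed.

Lemma sum_nat_card (T : finType) (P : pred T) : \sum_x P x = #|P|.
Proof.
rewrite -sum1_card [RHS]big_mkcond; apply: eq_bigr => x _.
by rewrite unfold_in; case: (P x).
Qed.

Lemma sum_system_vertex (F : system_vertex -> nat) : \sum_v F v =
  \sum_j F (anchor j) + \sum_p F (literal p.1 p.2) +
  \sum_p F (local_sol p.1 p.2.1 p.2.2).
Proof.
rewrite !big_sumType /=; congr (_ + _ + _); apply: eq_bigr => -[] //.
by move=> k [].
Qed.

Lemma degree_anchor j : degree (anchor j) = #|I|.-1 + below j * 2 + #|K| * 4.
Proof.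
rewrite /degree sum_system_vertex /=; congr (_ + _ + _).
- rewrite (sum_nat_card [pred j' | j != j']) -(cardC1 j).
  by apply: eq_card => i; rewrite !inE eq_sym.
- rewrite (sum_nat_card [pred p | enum_rank p.1 < enum_rank j]).
  rewrite -card_bool -cardX.
  by apply: eq_card => -[i e]; rewrite !inE andbT.
- by rewrite sum1_card !card_prod card_bool.
Qed.

(** The literal misses the anchor of its own variable and at least one local solution
of any equation. *)
Lemma degree_literal i e : 0 < #|K| -> degree (literal i e) < #|I|.-1 + #|K| * 4.
Proof.
move=> /card_gt0P[k _]; rewrite /degree sum_system_vertex /=.
rewrite (sum_nat_card [pred j | enum_rank i < enum_rank j]).
rewrite (sum_nat_card [pred p | agree i e p.1 p.2.1 p.2.2]) big1 // addn0.
rewrite -addnS leq_add//.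
  rewrite -(cardC1 i); apply/subset_leq_card/fintype.subsetP => j; rewrite !inE.
  by apply: contraTneq => ->; rewrite ltnn.
have -> : #|K| * 4 = #|{: K * (bool * bool)}| by rewrite !card_prod card_bool.
apply/proper_card/fintype.properP; split; first exact/fintype.subsetP.
have [|i1] := eqVneq i (var1 k); last have [|i2] := eqVneq i (var2 k).
- by move=> ->; exists (k, (~~ e, true)); rewrite !inE// agree1; case: e.
- by move=> ->; exists (k, (true, ~~ e)); rewrite !inE// agree2; case: e.
- exists (k, (~~ e, false)); rewrite !inE// /agree (negPf i1) (negPf i2) /=.
  by rewrite addbF; case: e; rewrite andbF.
Qed.

Lemma degree_local_sol k s t : 1 < #|K| ->
  degree (local_sol k s t) < #|I|.-1 + #|K| * 4.
Proof.
move=> K2; rewrite /degree sum_system_vertex sum1_card /=.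
rewrite (sum_nat_card [pred p | agree p.1 p.2 k s t]) [X in _ + _ + X]big1 // addn0.
have I0 : 0 < #|I| by apply/card_gt0P; exists (var1 k).
have : #|[pred p : I * bool | agree p.1 p.2 k s t]| <=
    size [:: (var1 k, s); (var2 k, t); (var3 k, s (+) t)].
  apply: leq_trans (card_size _); apply/subset_leq_card/fintype.subsetP => -[i e].
  by rewrite !inE /agree !xpair_eqE /=.
have arith m p d : 0 < m -> 1 < p -> d <= 3 -> m + d < m.-1 + p * 4 by lia.
by rewrite [X in _ -> X + _ < _](_ : _ = #|I|); [exact: arith | exact: eq_card].
Qed.

Section Automorphism.
Hypothesis K2 : 1 < #|K|.
Hypothesis trivial_sol : forall f : I -> bool,
  (forall k, f (var1 k) (+) f (var2 k) = f (var3 k)) -> forall i, f i = false.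
Variable sigma : {perm system_vertex}.
Hypothesis sigma_edge : forall v w, system_edge (sigma v) (sigma w) = system_edge v w.

Lemma degree_aut v : degree (sigma v) = degree v.
Proof.
rewrite /degree (reindex_inj (@perm_inj _ sigma)) /=.
by apply: eq_bigr => w _; rewrite sigma_edge.
Qed.

(** The degrees of the anchors exceed those of all other vertices and are strictly
increasing. *)
Lemma aut_anchor j : sigma (anchor j) = anchor j.
Proof.
have := degree_aut (anchor j); rewrite degree_anchor.
case: (sigma _) => [[j'|[i e]]|[k [s t]]] h.
- rewrite -/(anchor j') degree_anchor in h.
  congr anchor; apply: enum_rank_inj; apply: val_inj => /=.
  by case: (ltngtP (enum_rank j') (enum_rank j)) => // /below_lt; lia.
- by have := @degree_literal i e (ltnW K2); rewrite -/(literal i e) in h; lia.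
- by have := @degree_local_sol k s t K2; rewrite -/(local_sol k s t) in h; lia.
Qed.

Lemma edge_anchor j v : system_edge (anchor j) (sigma v) = system_edge (anchor j) v.
Proof. by rewrite -{1}(aut_anchor j) sigma_edge. Qed.

Lemma aut_not_anchor v j : sigma v = anchor j -> v = anchor j.
Proof. by rewrite -{1}(aut_anchor j) => /perm_inj. Qed.

(** A vertex other than an anchor is a literal of i exactly when it has i for largest
non-adjacent anchor; local solutions are adjacent to every anchor. *)
Lemma aut_literal i e : exists e', sigma (literal i e) = literal i e'.
Proof.
have := fun j => edge_anchor j (literal i e).
case E : (sigma _) => [[j'|[i' e']]|[k [s t]]] H.
- by have := aut_not_anchor E.
- exists e'; congr literal; apply: enum_rank_inj; apply: val_inj => /=.
  have := H i; have := H i'; rewrite /= !ltnn.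
  by case: (ltngtP (enum_rank i') (enum_rank i)).
- by have := H i; rewrite /= ltnn.
Qed.

Definition flip i : bool :=
  if sigma (literal i false) is inl (inr (_, e)) then e else false.

Lemma aut_flip i e : sigma (literal i e) = literal i (e (+) flip i).
Proof.
have [e0 E0] := aut_literal i false; have [e1 E1] := aut_literal i true.
have -> : flip i = e0 by rewrite /flip E0.
case: e; last by rewrite E0.
rewrite E1; congr literal; case: e0 e1 E0 E1 => -[] // E0 E1.
  by have := perm_inj (etrans E0 (esym E1)).
by have := perm_inj (etrans E0 (esym E1)).
Qed.

(** The literals adjacent to a local solution determine its equation, and the
automorphism does not move literals to other variables. *)
Lemma aut_local_sol k s t :
  exists s' t', sigma (local_sol k s t) = local_sol k s' t' /\
    forall i e, agree i (e (+) flip i) k s' t' = agree i e k s t.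
Proof.
have H i e := sigma_edge (literal i e) (local_sol k s t).
have := fun j => edge_anchor j (local_sol k s t).
case E : (sigma _) => [[j'|[i' e']]|[k' [s' t']]] Hj.
- by have := aut_not_anchor E.
- by have := Hj i'; rewrite /= ltnn.
have {}H i e : agree i (e (+) flip i) k' s' t' = agree i e k s t.
  by have := H i e; rewrite E aut_flip.
have kk' : k = k'.
  apply: vars_con_inj.
  - by have := H (var1 k) s; rewrite agree1 eqxx => /agree_vars.
  - by have := H (var2 k) t; rewrite agree2 eqxx => /agree_vars.
  - by have := H (var3 k) (s (+) t); rewrite agree3 eqxx => /agree_vars.
by exists s', t'; split; [rewrite kk' | move=> i e; rewrite -[RHS]H kk'].
Qed.

Lemma aut_trivial v : sigma v = v.
Proof.
have flip0 : forall i, flip i = false.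
  apply: trivial_sol => k; have [s [t [_ H]]] := aut_local_sol k false false.
  have := H (var1 k) false; have := H (var2 k) false; have := H (var3 k) false.
  rewrite !agree1 !agree2 !agree3 !addFb eqxx.
  by move=> /eqP -> /eqP -> /eqP ->.
case: v => [[j|[i e]]|[k [s t]]]; first exact: aut_anchor.
  by rewrite -/(literal i e) aut_flip flip0 addbF.
have [s' [t' [E H]]] := aut_local_sol k s t; rewrite -/(local_sol k s t) E.
have := H (var1 k) s; have := H (var2 k) t; rewrite !flip0 !addbF.
by rewrite !agree1 !agree2 !eqxx => /eqP -> /eqP ->.
Qed.

End Automorphism.

(** An automorphism flips the literals of some of the variables. Local solutions
must be mapped to local solutions, so that the set of flipped variables is a
solution of the system. The bound on the number of equations ensures that the
anchors have higher degree than the local solutions. *)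
Lemma system_graph_asymmetric : 1 < #|K| ->
  (forall f : I -> bool,
    (forall k, f (var1 k) (+) f (var2 k) = f (var3 k)) -> forall i, f i = false) ->
  graph_aut system_graph = [set 1%g]%SET.
Proof.
move=> K2 trivial_sol; apply/setP => sigma; rewrite !inE.
apply/forallP/eqP => [H|-> v]; last by apply/forallP => w; rewrite !perm1.
apply/permP => v; rewrite perm1; apply: aut_trivial => // x y.
by have /forallP/(_ y)/eqP := H x.
Qed.

Lemma card_system_graph : #|I| <= #|system_graph|.
Proof. by rewrite !card_sum -addnA leq_addr. Qed.

End SystemGraph.

(** * The quantum automorphism given by a quantum solution *)

Section QuantumSymmetry.
Variables (R : realType) (B : cstarAlgType R) (S : xor_system).
Variable X : var S -> B.
Hypothesis X_star : forall i, star (X i) = X i.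
Hypothesis X_sqr : forall i, X i * X i = 1.
Hypothesis X_con : forall k, X (var1 k) * X (var2 k) = X (var3 k).

(** The projection onto the eigenspace of X_i for the eigenvalue (-1)^e. *)
Definition spec_proj (i : var S) (e : bool) : B :=
  (2^-1 : R[i]) *: (1 + (-1) ^+ e *: X i).

Lemma X_spec_proj i e : X i * spec_proj i e = (-1) ^+ e *: spec_proj i e.
Proof.
rewrite /spec_proj -scalerAr mulrDr mulr1 -scalerAr X_sqr.
rewrite [RHS]scalerA [_ * 2^-1]mulrC -scalerA; congr (_ *: _).
by rewrite [RHS]scalerDr [X in _ = _ + X]scalerA -expr2 sqrr_sign scale1r addrC.
Qed.

Lemma spec_proj_mul i e e' :
  spec_proj i e * spec_proj i e' = if e == e' then spec_proj i e' else 0.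
Proof.
rewrite {1}/spec_proj -scalerAl mulrDl mul1r -scalerAl X_spec_proj scalerA.
rewrite -signr_addb -[X in X + _]scale1r -scalerDl scalerA.
case: e e' => -[] /=; rewrite ?expr1 ?subrr ?mulr0 ?scale0r// -[1 + 1]/2;
  by rewrite mulVf ?scale1r// pnatr_eq0.
Qed.

Lemma spec_proj_star i e : star (spec_proj i e) = spec_proj i e.
Proof.
rewrite /spec_proj starZ starD star1 starZ X_star; congr (_ *: (_ + _ *: _)).
- by rewrite fmorphV rmorph_nat.
- exact: rmorph_sign.
Qed.

Lemma spec_proj_sum i e : \sum_e' spec_proj i (e (+) e') = 1.
Proof.
have -> : \sum_e' spec_proj i (e (+) e') = spec_proj i false + spec_proj i true.
  by rewrite big_bool /=; case: e; rewrite // addrC.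
rewrite -scalerDr addrACA expr0 expr1 scale1r scaleN1r subrr addr0.
rewrite -[1 + 1]/((1 : B) *+ 2) -[(1 : B) *+ 2]scaler_nat scalerA.
by rewrite mulVf ?scale1r// pnatr_eq0.
Qed.

(** X_a X_b = X_c is self-adjoint, so it equals its adjoint X_b X_a. *)
Lemma X_comm k : X (var1 k) * X (var2 k) = X (var2 k) * X (var1 k).
Proof. by rewrite X_con -[LHS]X_star -X_con starM !X_star. Qed.

Lemma X_spec_proj_comm k s :
  X (var2 k) * spec_proj (var1 k) s = spec_proj (var1 k) s * X (var2 k).
Proof.
by rewrite /spec_proj -scalerAr -scalerAl mulrDr mulrDl mulr1 mul1r -scalerAr
  -scalerAl X_comm.
Qed.

Lemma spec_proj_comm k s t : spec_proj (var1 k) s * spec_proj (var2 k) t =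
  spec_proj (var2 k) t * spec_proj (var1 k) s.
Proof.
move: (spec_proj (var1 k) s) (X_spec_proj_comm k s) => p pX.
rewrite /spec_proj -scalerAr -scalerAl mulrDr mulrDl mulr1 mul1r -scalerAr.
by rewrite -scalerAl pX.
Qed.

Definition joint_proj (k : con S) (s t : bool) : B :=
  spec_proj (var1 k) s * spec_proj (var2 k) t.

Lemma joint_proj_star k s t : star (joint_proj k s t) = joint_proj k s t.
Proof. by rewrite starM !spec_proj_star -spec_proj_comm. Qed.

Lemma joint_proj_idem k s t : joint_proj k s t * joint_proj k s t = joint_proj k s t.
Proof.
rewrite /joint_proj mulrA -(mulrA (spec_proj _ s)) -spec_proj_comm.
by rewrite mulrA spec_proj_mul eqxx -mulrA spec_proj_mul eqxx.
Qed.

Lemma X_joint_proj k s t :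
  X (var3 k) * joint_proj k s t = (-1) ^+ (s (+) t) *: joint_proj k s t.
Proof.
rewrite -X_con /joint_proj -mulrA (mulrA (X (var2 k))) X_spec_proj_comm.
rewrite -mulrA X_spec_proj -scalerAr -scalerAr mulrA X_spec_proj -scalerAl scalerA.
by rewrite -signr_addb addbC.
Qed.

(** On the range of the joint projection the involutions of the equation k act by
the signs of the local solution (s, t), also for the third one because
X_a X_b = X_c. *)
Lemma spec_joint_orth i k e s t : vars_spec k i -> ~~ agree i e k s t ->
  spec_proj i e * joint_proj k s t = 0.
Proof.
case=> ->; rewrite ?agree1 ?agree2 ?agree3 => /negPf est.
- by rewrite mulrA spec_proj_mul est mul0r.
- by rewrite /joint_proj spec_proj_comm mulrA spec_proj_mul est mul0r.
- rewrite /spec_proj -scalerAl mulrDl mul1r -scalerAl X_joint_proj scalerA.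
  rewrite -signr_addb -[X in X + _]scale1r -scalerDl.
  by case: e s t est => -[] [] //= _; rewrite expr1 subrr scale0r scaler0.
Qed.

(** In the commutative case, where X_i is the sign (-1)^(f i), this is the permutation
matrix of the automorphism that translates literals and local solutions by f. *)
Definition system_magic (v w : system_graph S) : B :=
  match v, w with
  | inl (inl j), inl (inl j') => (j == j')%:R
  | inl (inr (i, e)), inl (inr (i', e')) =>
      if i == i' then spec_proj i (e (+) e') else 0
  | inr (k, (s, t)), inr (k', (s', t')) =>
      if k == k' then joint_proj k (s (+) s') (t (+) t') else 0
  | _, _ => 0
  end.

Lemma system_magic_sym v w : system_magic v w = system_magic w v.
Proof.
case: v w => [[j|[i e]]|[k [s t]]] [[j'|[i' e']]|[k' [s' t']]] //=.
- by rewrite eq_sym.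
- by rewrite eq_sym addbC; case: eqVneq => [->|].
- by rewrite eq_sym addbC [t (+) _]addbC; case: eqVneq => [->|].
Qed.

Lemma sum_system_graph (F : system_graph S -> B) : \sum_w F w =
  \sum_j F (anchor j) + \sum_i \sum_e F (literal i e) +
  \sum_k \sum_s \sum_t F (local_sol k s t).
Proof.
rewrite !big_sumType /=; congr (_ + _ + _).
  by rewrite pair_bigA; apply: eq_bigr => -[].
transitivity (\sum_k \sum_p F (inr (k, p))).
  by rewrite pair_bigA; apply: eq_bigr => -[].
apply: eq_bigr => k _.
by rewrite pair_bigA; apply: eq_bigr => -[].
Qed.

Lemma system_magic_row v : \sum_w system_magic v w = 1.
Proof.
rewrite sum_system_graph; case: v => [[j|[i e]]|[k [s t]]] /=.
- rewrite [X in _ + X]big1 => [|k _]; last by rewrite big1// => s _; rewrite big1.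
  rewrite [X in _ + X + _]big1 => [|i _]; last by rewrite big1.
  rewrite !addr0 (bigD1 j)//= eqxx big1 ?addr0// => j' /negPf.
  by rewrite eq_sym => ->.
- rewrite [X in _ + X]big1 => [|k _]; last by rewrite big1// => s _; rewrite big1.
  rewrite big1// add0r addr0 (bigD1 i)//= eqxx spec_proj_sum big1 ?addr0//.
  by move=> i' /negPf ii'; rewrite eq_sym ii' big1.
- rewrite big1// add0r big1 => [|i _]; last by rewrite big1.
  rewrite add0r (bigD1 k)//= eqxx [X in _ + X]big1 => [|k' /negPf kk']; last first.
    by rewrite eq_sym kk' big1// => s' _; rewrite big1.
  under eq_bigr do rewrite -mulr_sumr spec_proj_sum mulr1.
  by rewrite addr0 spec_proj_sum.
Qed.

Lemma agree_addb i e e' (k : con S) s s' t t' :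
  agree i e k s t != agree i e' k s' t' ->
  vars_spec k i /\ ~~ agree i (e (+) e') k (s (+) s') (t (+) t').
Proof.
move=> ne; have ik : vars_spec k i.
  case A : (agree i e k s t); first exact: agree_vars A.
  case A' : (agree i e' k s' t'); first exact: agree_vars A'.
  by rewrite A A' eqxx in ne.
split=> //; case: ik ne => ->; rewrite ?agree1 ?agree2 ?agree3.
- by case: e e' s s' => [] [] [] [].
- by case: e e' t t' => [] [] [] [].
- by case: e e' s s' t t' => [] [] [] [] [] [].
Qed.

(** Only the adjacency between a literal and a local solution is not constant on
blocks. There the difference of two literals disagrees with the difference of
two local solutions as soon as exactly one of the pairs is adjacent, and the
projections are then orthogonal. *)
Lemma system_magic_relations : qut_relations system_magic.
Proof.
have star0 : star (0 : B) = 0 by rewrite -(scale0r (0 : B)) starZ rmorph0 !scale0r.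
have starC n : star (n%:R : B) = n%:R.
  by elim: n => [|n IH]; [exact: star0 | rewrite mulrS starD IH star1].
have magic_star v w : star (system_magic v w) = system_magic v w.
  case: v w => [[j|[i e]]|[k [s t]]] [[j'|[i' e']]|[k' [s' t']]] //=;
    try exact: star0.
  - by case: ifP => _; rewrite ?spec_proj_star//; exact: star0.
  - by case: ifP => _; rewrite ?joint_proj_star//; exact: star0.
split=> [//|v w|v|v|v w v' w'].
- case: v w => [[j|[i e]]|[k [s t]]] [[j'|[i' e']]|[k' [s' t']]] //=;
    rewrite ?mulr0// ?(fun_if (fun x => x * x)).
  + by rewrite -natrM mulnb andbb.
  + by case: ifP => _; rewrite ?mulr0// spec_proj_mul eqxx.
  + by case: ifP => _; rewrite ?mulr0// joint_proj_idem.
- exact: system_magic_row.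
- by under eq_bigr do rewrite system_magic_sym; exact: system_magic_row.
- have literal_sol i e i2 e2 k s t k2 s2 t2 :
      agree i e k s t != agree i2 e2 k2 s2 t2 ->
      system_magic (literal i e) (literal i2 e2) *
      system_magic (local_sol k s t) (local_sol k2 s2 t2) = 0.
    rewrite /=; case: (eqVneq i i2) => [<-|_]; last by rewrite mul0r.
    case: (eqVneq k k2) => [<-|_]; last by rewrite mulr0.
    by case/agree_addb; exact: spec_joint_orth.
  case: v w v' w' => [[j|[i e]]|[k [s t]]] [[j2|[i2 e2]]|[k2 [s2 t2]]] //=;
    rewrite ?mul0r// => -[[j'|[i' e']]|[k' [s' t']]];
    move=> [[j2'|[i2' e2']]|[k2' [s2' t2']]] //=;
    rewrite ?mulr0//; try by rewrite mul0r.
  + case: (eqVneq j j2) => [<-|_]; last by rewrite mul0r.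
    by case: (eqVneq j' j2') => [<-|_]; rewrite ?mulr0// eqxx.
  + case: (eqVneq j j2) => [<-|_]; last by rewrite mul0r.
    by case: (eqVneq i' i2') => [<-|_]; rewrite ?mulr0// eqxx.
  + case: (eqVneq i i2) => [<-|_]; last by rewrite mul0r.
    by case: (eqVneq j' j2') => [<-|_]; rewrite ?mulr0// eqxx.
  + exact: literal_sol.
  + move=> ne; apply: (can_inj (@starK _ B)); rewrite starM star0.
    rewrite (magic_star (literal i' e') (literal i2' e2')).
    by rewrite (magic_star (local_sol k s t) (local_sol k2 s2 t2)) literal_sol.
Qed.

Lemma system_graph_Qut_nontrivial i :
  X i != 1 -> X i != -1 -> ~ Qut_trivial R (system_graph S).
Proof.
move=> X1 XN1.
have two0 : (2^-1 : R[i]) != 0 by rewrite invr_eq0 pnatr_eq0.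
have E : system_magic (literal i false) (literal i false) = (2^-1 : R[i]) *: (1 + X i).
  by rewrite /= eqxx /spec_proj expr0 scale1r.
apply: (@nontrivial_Qut R (system_graph S) B system_magic (literal i false)
  (literal i false) system_magic_relations); rewrite E.
- rewrite scaler_eq0 negb_or two0 /=; apply: contra_neq XN1 => /eqP.
  by rewrite addrC addr_eq0 => /eqP.
- apply: contra_neq X1 => /(congr1 (fun x => (2 : R[i]) *: x)).
  rewrite scalerA mulfV ?pnatr_eq0// scale1r scaler_nat mulr2n.
  exact: addrI.
Qed.

End QuantumSymmetry.

(** * Systems of commuting involutions; double transpositions *)

Section InvolutionSystem.
Variables (gT : finGroupType) (D : {set gT}).
Local Open Scope group_scope.

Local Notation elt := {x : gT | x \in D}.
Local Notation rank := (fun v : elt => nat_of_ord (enum_rank v)).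

Definition inv_con_pred (p : elt * elt * elt) : bool :=
  (rank p.1.1 < rank p.1.2 < rank p.2)%N && (val p.1.1 * val p.1.2 == val p.2).

Definition inv_con := {p : elt * elt * elt | inv_con_pred p}.

Fact inv_sorted (k : inv_con) :
  (rank (val k).1.1 < rank (val k).1.2 < rank (val k).2)%N.
Proof. by case/andP: (valP k). Qed.

Fact inv_con_inj (k k' : inv_con) :
  (val k).1.1 = (val k').1.1 -> (val k).1.2 = (val k').1.2 -> k = k'.
Proof.
move=> h1 h2; apply: val_inj.
case: k k' h1 h2 => [[[s t] w] /= Hk] [[[s' t'] w'] /= Hk'] e1 e2.
subst s' t'; congr (_, _); apply: val_inj.
by case/andP: Hk => _ /eqP <-; case/andP: Hk' => _ /eqP <-.
Qed.

Definition involution_system : xor_system := XorSystem inv_sorted inv_con_inj.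

Definition inv_var x (xD : x \in D) : var involution_system := (Sub x xD : elt).

Lemma inv_conP (k : con involution_system) :
  val (var1 k) * val (var2 k) = val (var3 k).
Proof. by case/andP: (valP k) => _ /eqP. Qed.

Hypothesis D_inv : forall x, x \in D -> x != 1 /\ x * x = 1.

(** If s t = w for involutions, then the product of any two of s, t, w in any order
is the third, so that one may sort them. *)
Lemma inv_con_of (s t w : var involution_system) : val s * val t = val w ->
  exists k : con involution_system,
    perm_eq [:: var1 k; var2 k; var3 k] [:: s; t; w].
Proof.
have mk (x y z : elt) : (rank x < rank y)%N -> (rank y < rank z)%N ->
    val x * val y = val z -> perm_eq [:: x; y; z] [:: s; t; w] ->
    exists k : con involution_system,
      perm_eq [:: var1 k; var2 k; var3 k] [:: s; t; w].
  move=> xy yz xyz pe; have Hk : inv_con_pred (x, y, z).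
    by rewrite /inv_con_pred /= xy yz xyz eqxx.
  by exists (exist _ (x, y, z) Hk).
have [s1 ss] := D_inv (valP s); have [t1 tt] := D_inv (valP t).
have [w1 ww] := D_inv (valP w).
move=> stw.
have sw : val s * val w = val t by rewrite -stw mulgA ss mul1g.
have wt : val w * val t = val s by rewrite -stw -mulgA tt mulg1.
have ts : val t * val s = val w by apply: (mulgI (val w)); rewrite mulgA wt ss ww.
have ws : val w * val s = val t by rewrite -ts -mulgA ss mulg1.
have tw : val t * val w = val s by rewrite -ts mulgA tt mul1g.
have neq (x y z : elt) : val x * val y = val z -> val z != 1 -> val y * val y = 1 ->
    rank x != rank y.
  move=> xyz z1 yy; apply: contra_neq z1 => /val_inj/enum_rank_inj xy.
  by rewrite -xyz xy yy.
have nst := neq _ _ _ stw w1 tt; have nsw := neq _ _ _ sw t1 ww.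
have ntw := neq _ _ _ tw s1 ww.
have [st|st|/eqP st] := ltngtP (rank s) (rank t); last by rewrite st in nst.
- have [tw'|wt'|/eqP e] := ltngtP (rank t) (rank w); last by rewrite e in ntw.
  + exact: (mk s t w).
  + have [sw'|ws'|/eqP e] := ltngtP (rank s) (rank w); last by rewrite e in nsw.
    * by apply: (mk s w t) => //; apply/seq.permP => p /=; ring.
    * by apply: (mk w s t) => //; apply/seq.permP => p /=; ring.
- have [sw'|ws'|/eqP e] := ltngtP (rank s) (rank w); last by rewrite e in nsw.
  + by apply: (mk t s w) => //; apply/seq.permP => p /=; ring.
  + have [tw'|wt'|/eqP e] := ltngtP (rank t) (rank w); last by rewrite e in ntw.
    * by apply: (mk t w s) => //; apply/seq.permP => p /=; ring.
    * by apply: (mk w t s) => //; apply/seq.permP => p /=; ring.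
Qed.

(** The equations are the sorted triples only, but by [inv_con_of] they imply
additivity for every x and y such that x y is in D. *)
Lemma inv_system_trivial_sol :
  (forall F : gT -> bool,
     (forall x y, x \in D -> y \in D -> x * y \in D -> F x (+) F y = F (x * y)) ->
     forall x, x \in D -> F x = false) ->
  forall f : var involution_system -> bool,
    (forall k, f (var1 k) (+) f (var2 k) = f (var3 k)) -> forall i, f i = false.
Proof.
move=> F0 f fk i.
pose F x := if insub x is Some v then f v else false.
have FE (v : elt) : F (val v) = f v by rewrite /F valK.
rewrite -FE; apply: F0 (valP i) => x y xD yD xyD.
pose s := inv_var xD; pose t := inv_var yD; pose w := inv_var xyD.
rewrite -[x * y]/(val w) -[x]/(val s) -[y]/(val t) !FE.
have [k /(perm_big _) pe] := @inv_con_of s t w erefl.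
have := pe _ addb false xpredT f; rewrite !big_cons !big_nil /= !addbF -fk.
by case: (f (var1 k)) (f (var2 k)) (f s) (f t) (f w) => [] [] [] [] [].
Qed.

End InvolutionSystem.

Section DoubleTranspositions.
Variable T : finType.
Local Open Scope group_scope.
Implicit Types a b c d p q x y z u v w : T.

Definition double_tperm a b c d : {perm T} := tperm a b * tperm c d.

Definition double_tperms : {set {perm T}} :=
  [set s | [exists a, exists b, exists c, exists d,
     uniq [:: a; b; c; d] && (s == double_tperm a b c d)]].

Lemma double_tpermsP s :
  reflect (exists a b c d, uniq [:: a; b; c; d] /\ s = double_tperm a b c d)
    (s \in double_tperms).
Proof.
rewrite inE; apply: (iffP existsP) => [[a /existsP[b /existsP[c]]]|].
  case/existsP=> d /andP[H /eqP E].
  by exists a, b, c, d.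
move=> [a [b [c [d [H ->]]]]]; exists a; apply/existsP; exists b; apply/existsP.
by exists c; apply/existsP; exists d; rewrite H eqxx.
Qed.

Lemma mem_double_tperms a b c d :
  uniq [:: a; b; c; d] -> double_tperm a b c d \in double_tperms.
Proof. by move=> H; apply/double_tpermsP; exists a, b, c, d. Qed.

Lemma tperm_comm a b c d : uniq [:: a; b; c; d] ->
  tperm a b * tperm c d = tperm c d * tperm a b.
Proof.
rewrite /= !inE !negb_or -!andbA => /and5P[ab ac ad bc /and3P[bd cd _]].
by rewrite conjgC tpermJ !tpermD// eq_sym.
Qed.

Lemma double_tperm_disjoint a b c d x y : uniq [:: a; b; c; d; x; y] ->
  double_tperm a b c d * double_tperm a b x y = double_tperm c d x y.
Proof.
move=> H; have abcd : uniq [:: a; b; c; d] by exact: (take_uniq 4 H).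
by rewrite /double_tperm (tperm_comm abcd) mulgA -(mulgA (tperm c d)) tperm2 mulg1.
Qed.

Lemma double_tperm_klein a b c d : uniq [:: a; b; c; d] ->
  double_tperm a b c d * double_tperm a c b d = double_tperm a d b c.
Proof.
rewrite /= !inE !negb_or -!andbA.
have neq u v : u != v -> ((u == v) = false) * ((v == u) = false).
  by move=> /negPf uv; split; rewrite // eq_sym.
case/and5P=> /neq ab /neq ac /neq ad /neq bc /and3P[/neq bd /neq cd _].
have tpE u v z : tperm u v z = if z == u then v else if z == v then u else z.
  case: tpermP => [->|->|/eqP/negPf-> /eqP/negPf->]//; rewrite ?eqxx//.
  by case: eqVneq.
have E := (permM, tpE, eqxx, ab, ac, ad, bc, bd, cd).
apply/permP => x.
have [->|xa] := eqVneq x a; first by rewrite !E.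
have [->|xb] := eqVneq x b; first by rewrite !E.
have [->|xc] := eqVneq x c; first by rewrite !E.
have [->|xd] := eqVneq x d; first by rewrite !E.
by rewrite !permM !tpermD // eq_sym.
Qed.

Lemma double_tperms_involution s : s \in double_tperms -> s != 1 /\ s * s = 1.
Proof.
case/double_tpermsP => a [b [c [d [H ->]]]]; split; last first.
  rewrite {1}/double_tperm (tperm_comm H) /double_tperm mulgA -(mulgA (tperm c d)).
  by rewrite tperm2 mulg1 tperm2.
move: H; rewrite /= !inE !negb_or -!andbA => /and5P[ab ac ad bc /and3P[bd cd _]].
apply/eqP => /permP/(_ a); rewrite permM perm1 tpermL tpermD 1?eq_sym//.
by move=> E; rewrite E eqxx in ab.
Qed.

Section TrivialHom.
Variable F : {perm T} -> bool.
Hypothesis F_hom : forall s t,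
  s \in double_tperms -> t \in double_tperms -> s * t \in double_tperms ->
  F s (+) F t = F (s * t).
Let g a b c d := F (double_tperm a b c d).

Let g_disjoint a b c d x y : uniq [:: a; b; c; d; x; y] ->
  g a b c d (+) g a b x y = g c d x y.
Proof.
move=> H; rewrite /g F_hom ?double_tperm_disjoint//; apply: mem_double_tperms.
- exact: (take_uniq 4 H).
- by apply: subseq_uniq H; apply/subseqP;
    exists [:: true; true; false; false; true; true].
- exact: (drop_uniq 2 H).
Qed.

Let g_klein a b c d : uniq [:: a; b; c; d] ->
  g a b c d (+) g a c b d = g a d b c.
Proof.
move=> H; rewrite /g F_hom ?double_tperm_klein//; apply: mem_double_tperms => //.
  by rewrite (@perm_uniq _ _ [:: a; b; c; d])//; apply/seq.permP => f /=; ring.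
by rewrite (@perm_uniq _ _ [:: a; b; c; d])//; apply/seq.permP => f /=; ring.
Qed.

(** The difference of two K_4 equations that share the triangle s, r, t. *)
Let xor_cancel (st rv sr tv sv tr rw tw sw : bool) :
  st (+) rv (+) (sr (+) tv) = sv (+) tr -> st (+) rw (+) (sr (+) tw) = sw (+) tr ->
  (sv (+) sw) (+) (tv (+) tw) = rv (+) rw.
Proof.
by case: st rv sr tv sv tr rw tw sw => [] [] [] [] [] [] [] [] [].
Qed.

(** With two auxiliary points q and p, the edge function is h u v = F((q p)(u v)).
Given v and w, let delta u = h u v + h u w. Two K_4 equations that share a
triangle on s, t, r give delta s + delta t + delta r = 0; on four points this
forces delta = 0, so that edges with a common endpoint have the same value of
h. Two disjoint edges both meet a third one. The count of eight points is q, p,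
the four points moved, and two more to have four points besides v and w. *)
Lemma double_tperms_trivial_hom :
  (8 <= #|T|)%N -> forall s, s \in double_tperms -> F s = false.
Proof.
move=> T8 _ /double_tpermsP[a [b [c [d [abcd ->]]]]].
have fresh (l : seq T) : (size l < 8)%N -> exists z, z \notin l.
  move=> l8; apply/existsP; rewrite -negb_forall; apply/forallP => H.
  have : (#|T| <= size l)%N.
    apply: leq_trans (card_size _); apply/subset_leq_card/fintype.subsetP.
    by move=> z _; exact: H.
  lia.
have [x Hx] := fresh [:: a; b; c; d] isT.
have [y Hy] := fresh [:: x; a; b; c; d] isT.
have [p Hp] := fresh [:: y; x; a; b; c; d] isT.
have [q Hq] := fresh [:: p; y; x; a; b; c; d] isT.
have U : uniq [:: q; p; y; x; a; b; c; d].
  by rewrite cons_uniq Hq cons_uniq Hp cons_uniq Hy cons_uniq Hx.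
pose h u v := g q p u v.
have hC u v : h u v = h v u by rewrite /h /g /double_tperm (tpermC u).
have h_pair u v w z : uniq [:: q; p; u; v; w; z] -> h u v (+) h w z = g u v w z.
  exact: g_disjoint.
have h_K4 u v w z : uniq [:: q; p; u; v; w; z] ->
    h u v (+) h w z (+) (h u w (+) h v z) = h u z (+) h v w.
  have perm l : perm_eq [:: q; p; u; v; w; z] l ->
      uniq [:: q; p; u; v; w; z] -> uniq l.
    by move=> /perm_uniq ->.
  move=> H; rewrite !h_pair ?g_klein//.
  - exact: (drop_uniq 2 H).
  - by apply: perm H; apply/seq.permP => f /=; ring.
  - by apply: perm H; apply/seq.permP => f /=; ring.
have h_star u x1 y1 z v w : uniq [:: q; p; u; x1; y1; z; v; w] -> h u v = h u w.
  move=> H; have K4 m u' v' w' z' :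
     mask (true :: true :: m) [:: q; p; u; x1; y1; z; v; w] =
       [:: q; p; u'; v'; w'; z'] ->
     h u' v' (+) h w' z' (+) (h u' w' (+) h v' z') = h u' z' (+) h v' w'.
    by move=> E; apply: h_K4; rewrite -E mask_uniq.
  pose delta t := h t v (+) h t w.
  have tri s t r : h s t (+) h r v (+) (h s r (+) h t v) = h s v (+) h t r ->
     h s t (+) h r w (+) (h s r (+) h t w) = h s w (+) h t r ->
     delta s (+) delta t = delta r.
    exact: xor_cancel.
  have := tri _ _ _ (K4 [:: true; true; true; false; true; false] _ _ _ _ erefl)
    (K4 [:: true; true; true; false; false; true] _ _ _ _ erefl).
  have := tri _ _ _ (K4 [:: true; true; false; true; true; false] _ _ _ _ erefl)
    (K4 [:: true; true; false; true; false; true] _ _ _ _ erefl).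
  have := tri _ _ _ (K4 [:: true; false; true; true; true; false] _ _ _ _ erefl)
    (K4 [:: true; false; true; true; false; true] _ _ _ _ erefl).
  rewrite -!/(delta _).
  move=> uyz uxz uxy; have : delta u = false.
    by move: uyz uxz uxy; case: (delta u) (delta x1) (delta y1) (delta z)=> [] [] [] [].
  by rewrite /delta; case: (h u v) (h u w) => [] [].
have perm l : perm_eq [:: q; p; y; x; a; b; c; d] l -> uniq l.
  by move=> /perm_uniq <-.
have ab_ac : h a b = h a c.
  by apply: (@h_star a d x y); apply: perm; apply/seq.permP => f /=; ring.
have ca_cd : h c a = h c d.
  by apply: (@h_star c b x y); apply: perm; apply/seq.permP => f /=; ring.
rewrite -/(g a b c d) -h_pair ?ab_ac ?(hC a c) ?ca_cd ?addbb//.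
by apply: subseq_uniq U; apply/subseqP;
  exists [:: true; true; false; false; true; true; true; true].
Qed.

End TrivialHom.
End DoubleTranspositions.

(** * The sequence of graphs *)

Section DoubleTranspositionGraph.
Variable n : nat.
Local Notation T := 'I_n.+4.+4.

Definition double_tperm_system : xor_system := involution_system (double_tperms T).
Definition double_tperm_graph : graph := system_graph double_tperm_system.

Let pt (i : nat) : T := inord i.

Let uniq_pt s : uniq s -> all (fun i => (i < 8)%N) s -> uniq (map pt s).
Proof.
move=> us /allP s8; rewrite map_inj_in_uniq// => i j /s8 i8 /s8 j8.
by move=> /(congr1 val); rewrite /= !inordK//; lia.
Qed.

(** The Klein four-groups on two disjoint sets of four points give two equations. *)
Lemma card_double_tperm_con : (1 < #|con double_tperm_system|)%N.
Proof.
have mk a b c d : uniq [:: a; b; c; d] ->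
    exists k : con double_tperm_system, exists s t w : var double_tperm_system,
    [/\ perm_eq [:: var1 k; var2 k; var3 k] [:: s; t; w],
       val s = double_tperm a b c d, val t = double_tperm a c b d &
       val w = double_tperm a d b c].
  move=> H; have H2 : uniq [:: a; c; b; d].
    by rewrite (@perm_uniq _ _ [:: a; b; c; d])//; apply/seq.permP => f /=; ring.
  have H3 : uniq [:: a; d; b; c].
    by rewrite (@perm_uniq _ _ [:: a; b; c; d])//; apply/seq.permP => f /=; ring.
  pose s : var double_tperm_system := inv_var (mem_double_tperms H).
  pose t : var double_tperm_system := inv_var (mem_double_tperms H2).
  pose w : var double_tperm_system := inv_var (mem_double_tperms H3).
  have [k Hk] :=
    @inv_con_of _ _ (@double_tperms_involution T) s t w (double_tperm_klein H).
  by exists k, s, t, w.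
have U : uniq [:: pt 0; pt 1; pt 2; pt 3; pt 4; pt 5; pt 6; pt 7].
  exact: (@uniq_pt [:: 0; 1; 2; 3; 4; 5; 6; 7]%N).
have [k [s [t [w [pk sk tk wk]]]]] := mk _ _ _ _ (take_uniq 4 U).
have [k' [s' [t' [w' [pk' sk' tk' wk']]]]] := mk _ _ _ _ (drop_uniq 4 U).
apply/card_gt1P; exists k, k'; split=> //; apply/eqP => kk'.
have : s' \in [:: s; t; w] by rewrite -(perm_mem pk) kk' (perm_mem pk') mem_head.
have npt (i j : nat) : (i < 8)%N -> (j < 8)%N -> i != j -> pt i != pt j.
  by move=> i8 j8; apply: contra_neq => /(congr1 val); rewrite /= !inordK//; lia.
have fix4 a b c d : (a < 4)%N -> (b < 4)%N -> (c < 4)%N -> (d < 4)%N ->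
    double_tperm (pt a) (pt b) (pt c) (pt d) (pt 4) = pt 4.
  by move=> a4 b4 c4 d4; rewrite permM !tpermD// npt//; lia.
have move4 : double_tperm (pt 4) (pt 5) (pt 6) (pt 7) (pt 4) = pt 5.
  by rewrite permM tpermL tpermD// npt.
have val4 (v : var double_tperm_system) : val v (pt 4) = pt 4 -> s' == v = false.
  move=> v4; apply/eqP => sv; have := npt 4 5 isT isT isT.
  by rewrite -move4 -sk' sv v4 eqxx.
by rewrite !inE !val4 ?sk ?tk ?wk ?fix4.
Qed.

(** The double transpositions (0 1)(2 x) are already numerous enough. *)
Lemma card_double_tperm_graph : (n < #|double_tperm_graph|)%N.
Proof.
apply: leq_trans (card_system_graph _); rewrite card_sig.
pose f (x : T) := double_tperm (pt 0) (pt 1) (pt 2) x.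
have U : uniq [:: pt 0; pt 1; pt 2] by exact: (@uniq_pt [:: 0; 1; 2]%N).
pose A : {set T} := (~: [set x in [:: pt 0; pt 1; pt 2]])%SET.
have AU x : x \in A -> uniq [:: pt 0; pt 1; pt 2; x].
  rewrite !inE => xA; rewrite (@perm_uniq _ _ [:: x; pt 0; pt 1; pt 2]).
    by rewrite cons_uniq U andbT !inE.
  by apply/seq.permP => g /=; ring.
have f2 x : x \in A -> f x (pt 2) = x.
  move=> /AU; rewrite /= !inE !negb_or => /and4P[/and3P[_ a2 _] /andP[b2 _] _ _].
  by rewrite permM (tpermD a2 b2) tpermL.
have finj : {in A &, injective f}.
  by move=> x y xA yA fxy; rewrite -(f2 x xA) fxy f2.
have sub : f @: A \subset double_tperms T.
  by apply/fintype.subsetP => _ /imsetP[x /AU xU ->]; exact: mem_double_tperms.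
have cA : (#|A| + 3 = n.+4.+4)%N.
  rewrite -[RHS](card_ord n.+4.+4) -(cardsC A) finset.setCK cardsE.
  by congr addn; rewrite -[LHS](card_uniqP U); apply: eq_card => x; rewrite !inE.
have := subset_leq_card sub; rewrite card_in_imset// => h.
by apply: leq_trans h; rewrite -(leq_add2r 3) cA; lia.
Qed.

Lemma double_tperm_graph_asymmetric : graph_aut double_tperm_graph = [set 1%g]%SET.
Proof.
apply: system_graph_asymmetric; first exact: card_double_tperm_con.
apply: inv_system_trivial_sol; first exact: double_tperms_involution.
by move=> F F_hom; apply: double_tperms_trivial_hom => //; rewrite card_ord.
Qed.

(** The representation is the defining one, by permutation matrices: entry (0, 1) of
the matrix of (0 1)(2 3) is 1, so the matrix is neither 1 nor -1. *)
Lemma double_tperm_graph_Qut (R : realType) : ~ Qut_trivial R double_tperm_graph.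
Proof.
pose X (v : var double_tperm_system) : 'M[R[i]]_n.+4.+4 := perm_mx (val v).
have Xmul v w : X v * X w = perm_mx (val v * val w)%g by rewrite /X perm_mxM.
have H0123 : uniq [:: pt 0; pt 1; pt 2; pt 3] by exact: (@uniq_pt [:: 0; 1; 2; 3]%N).
pose s : var double_tperm_system := inv_var (mem_double_tperms H0123).
have s0 : val s (pt 0) = pt 1.
  rewrite permM tpermL tpermD// eq_sym;
  by move: (H0123); rewrite /= !inE !negb_or => /and4P[_ /andP[? ?] _ _].
have p01 : pt 0 == pt 1 = false.
  by apply/negbTE; move: (H0123); rewrite /= !inE !negb_or -!andbA => /andP[].
have X01 : X s (pt 0) (pt 1) = 1 by rewrite !mxE s0 eqxx.
apply: (@system_graph_Qut_nontrivial R 'M[R[i]]_n.+4.+4 double_tperm_system X _ _ _ s).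
- move=> v; apply/matrixP=> i j; rewrite !mxE rmorph_nat.
  have [_ vv] := double_tperms_involution (valP v); congr (_%:R); congr nat_of_bool.
  by apply/eqP/eqP => <-; rewrite -permM vv perm1.
- by move=> v; rewrite Xmul (double_tperms_involution (valP v)).2 perm_mx1.
- by move=> k; rewrite Xmul inv_conP.
- apply/eqP => /matrixP/(_ (pt 0) (pt 1)); rewrite X01 !mxE p01.
  by apply/eqP; rewrite oner_eq0.
- apply/eqP => /matrixP/(_ (pt 0) (pt 1)); rewrite X01 !mxE p01 oppr0.
  by apply/eqP; rewrite oner_eq0.
Qed.

End DoubleTranspositionGraph.

Theorem theoremA (R : realType) :
  exists G : nat -> graph,
    (forall i j : nat, i <> j -> ~ graph_iso (G i) (G j)) /\
    (forall i : nat, graph_aut (G i) = [set 1%g]%SET /\ ~ Qut_trivial R (G i)).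
Proof.
(* each graph is built on at least as many points as the previous graph has
   vertices, which makes the numbers of vertices strictly increasing *)
pose m := fix m k := if k is k'.+1 then #|double_tperm_graph (m k')| else 0%N.
exists (fun k => double_tperm_graph (m k)); split; last first.
  by move=> i; split;
    [exact: double_tperm_graph_asymmetric | exact: double_tperm_graph_Qut].
have lt_card i j :
    (i < j)%N -> (#|double_tperm_graph (m i)| < #|double_tperm_graph (m j)|)%N.
  elim: j => // j IH; rewrite ltnS leq_eqVlt => /orP[/eqP ->|/IH ij].
    exact: (@card_double_tperm_graph (m j.+1)).
  exact: ltn_trans ij (@card_double_tperm_graph (m j.+1)).
move=> i j ij [f fbij _]; have := bij_eq_card fbij.
by case: (ltngtP i j) => // /lt_card; lia.
Qed.
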